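(* Let $d\ge2$, $0\le k\le d-1$ and $r\ge1$, and let $T\subset\mathbb R^d$ be a $d$-simplex. Define $$\mathbb B_r\Lambda^k(T):=\bigoplus_{\ell=d-k}^{d}\ \bigoplus_{f\in\Delta_\ell(T)}\left[\mathbb P_{r-(\ell+1)}(f)\otimes b_f\star_T\operatorname{Alt}^{d-k}(\mathscr T^f)\right]\subseteq\mathbb P_r\Lambda^k(T).$$ Then $$\mathbb B_r\Lambda^k(T)=\mathbb P_r\Lambda^k(T)\cap\ker(\operatorname{tr}_{\partial T}).$$
   Context: $T$ has barycentric coordinates $\lambda_0,\dots,\lambda_d$. $\Delta_\ell(T)$ is the set of $\ell$-dimensional subsimplices of $T$; each is identified with its set of vertex indices. $\mathscr T^f\subseteq\mathbb R^d$ is the tangent space of $f$ (span of differences of vertices), $\mathscr T^T=\mathbb R^d$. $\operatorname{Alt}^k(V)$ is the space of alternating $k$-linear forms on $V$; $\operatorname{Alt}^m(\mathscr T^f)$ is embedded in $\operatorname{Alt}^m(\mathscr T^T)$ by pullback along the orthogonal projection $\mathbb R^d\to\mathscr T^f$. $\star_T:\operatorname{Alt}^{m}(\mathbb R^d)\to\operatorname{Alt}^{d-m}(\mathbb R^d)$ is the Hodge star. $b_f:=\prod_{i\in f}\lambda_i$. For $m\ge0$, $\mathbb P_m(f)$ is the space of polynomials of degree $\le m$ on $f$ (equal to $\mathbb R$ if $f$ is a vertex), viewed inside $\mathbb P_m(T)$ through the Bernstein extension, i.e. as the span of the monomials $\prod_{i\in f}\lambda_i^{\alpha_i}$ with $\sum_{i\in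 f}\alpha_i=m$; $\mathbb P_m(f)=\{0\}$ for $m<0$. $\mathbb P_r\Lambda^k(T)=\mathbb P_r(T)\otimes\operatorname{Alt}^k(\mathscr T^T)$ is the space of polynomial $k$-forms of degree $\le r$. For a facet $F\in\Delta_{d-1}(T)$, $\operatorname{tr}_F\omega$ is the pullback of $\omega$ under the inclusion $F\hookrightarrow T$, and $\operatorname{tr}_{\partial T}\omega$ is the collection of all $\operatorname{tr}_F\omega$, $F\in\Delta_{d-1}(T)$; thus $\omega\in\ker(\operatorname{tr}_{\partial T})$ iff $\operatorname{tr}_F\omega=0$ for every facet $F$. *)

(* Defs.v *)
From HB Require Import structures.
From mathcomp Require Import all_boot all_order all_algebra perm.
From mathcomp Require Import boolp classical_sets functions reals.
From mathcomp Require Import mpoly.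

Set Implicit Arguments.
Unset Strict Implicit.
Unset Printing Implicit Defensive.

Import Order.TTheory GRing.Theory Num.Theory.

Local Open Scope classical_set_scope.
Local Open Scope ring_scope.

Section Sums.
Variables (R : pzRingType) (V : lmodType R).

Definition span_set (S : set V) : set V :=
  [set x | exists (n : nat) (c : 'I_n -> R) (s : 'I_n -> V),
     (forall i, S (s i)) /\ x = \sum_i c i *: s i].

Variables (I : finType) (P : pred I) (S : I -> set V).

Definition sum_set : set V :=
  [set x | exists u : I -> V,
     (forall i, P i -> S i (u i)) /\ x = \sum_(i | P i) u i].

Definition direct_set : Prop :=
  forall u : I -> V, (forall i, P i -> S i (u i)) ->
    \sum_(i | P i) u i = 0 -> forall i, P i -> u i = 0.

End Sums.

Section AltForms.
Variable R : realType.

Definition altform (V : lmodType R) (k : nat) : set ({ffun 'I_k -> V} -> R) :=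
  [set a | (forall (v : {ffun 'I_k -> V}) (i : 'I_k),
              scalar (fun x : V => a (finfun (dfwith v (i := i) x))))
        /\ (forall (v : {ffun 'I_k -> V}) (i j : 'I_k),
              i != j -> v i = v j -> a v = 0)].
Arguments altform V k : clear implicits.

Variable d : nat.
Implicit Types (U : {vspace 'rV[R]_d}) (x y : 'rV[R]_d).

Definition dotv x y : R := \sum_(j < d) x 0 j * y 0 j.

Definition dotv_basis U x : 'rV[R]_(\dim U) :=
  \row_(i < \dim U) dotv (vbasis U)`_i x.

(* The orthogonal complement of U, see mem_orthv. *)
Definition orthv U : {vspace 'rV[R]_d} := lker (linfun (dotv_basis U)).

Lemma dotvC x y : dotv x y = dotv y x.
Proof. by apply: eq_bigr => j _; rewrite mulrC. Qed.

Lemma dotv_linear x : scalar (dotv x).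
Proof.
move=> a y z; rewrite /dotv mulr_sumr -big_split /=.
by apply: eq_bigr => j _; rewrite !mxE mulrDr mulrCA.
Qed.

Lemma dotvD x y z : dotv x (y + z) = dotv x y + dotv x z.
Proof. by have := dotv_linear x 1 y z; rewrite scale1r mul1r. Qed.

Lemma dotv0 x : dotv x 0 = 0.
Proof. by rewrite /dotv big1 // => j _; rewrite mxE mulr0. Qed.

Lemma dotvZ x a y : dotv x (a *: y) = a * dotv x y.
Proof. by have := dotv_linear x a y 0; rewrite addr0 dotv0 addr0. Qed.

Lemma dotv_eq0 x : dotv x x = 0 -> x = 0.
Proof.
move=> /eqP; rewrite psumr_eq0 => [|j _]; last by rewrite -expr2 sqr_ge0.
move=> /allP x0; apply/rowP => j; rewrite mxE.
by have := x0 j (mem_index_enum j); rewrite mulf_eq0 orbb => /eqP.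
Qed.

Lemma dotv_basis_is_linear U : linear (dotv_basis U).
Proof. by move=> a x y; apply/rowP => i; rewrite !mxE dotv_linear. Qed.

HB.instance Definition _ U :=
  GRing.isLinear.Build R 'rV[R]_d 'rV[R]_(\dim U) _ (dotv_basis U)
    (dotv_basis_is_linear U).

Lemma mem_orthv U x :
  reflect (forall u, u \in U -> dotv u x = 0) (x \in orthv U).
Proof.
rewrite memv_ker lfunE /=; apply: (iffP eqP) => [x0 u|x0].
  move=> /coord_vbasis ->; rewrite dotvC; elim/big_rec: _ => [|i y _ IH].
    by rewrite dotv0.
  have := congr1 (fun z : 'rV_(\dim U) => z 0 i) x0; rewrite !mxE => xi.
  by rewrite dotvD IH dotvZ dotvC xi mulr0 addr0.
apply/rowP => i; rewrite !mxE x0 // vbasis_mem // mem_nth //.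
by rewrite size_tuple.
Qed.

Lemma capv_orthv U : (U :&: orthv U = 0)%VS.
Proof.
apply/eqP; rewrite -subv0; apply/subvP => x /memv_capP [xU /mem_orthv xo].
by rewrite memv0 (dotv_eq0 (xo x xU)).
Qed.

Lemma addv_orthv U : (U + orthv U = fullv)%VS.
Proof.
apply/eqP; rewrite eqEdim subvf /= dimv_disjoint_sum ?capv_orthv //.
rewrite -(limg_ker_dim (linfun (dotv_basis U)) fullv) capfv addnC leq_add2r.
by rewrite (leq_trans (dimvS (subvf _))) // dimvf /dim /= mul1n.
Qed.

Definition orth_proj U (x : 'rV[R]_d) : subvs_of U :=
  vsproj U (daddv_pi U (orthv U) x).

Lemma orth_projP U x u :
  u \in U -> dotv u (x - vsval (orth_proj U x)) = 0.
Proof.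
move=> uU; rewrite /orth_proj vsprojK ?memv_pi //.
have xE := daddv_pi_add (capv_orthv U) (_ : x \in U + orthv U)%VS.
rewrite -{1}xE ?addv_orthv ?memvf // addrAC subrr add0r.
by move: u uU; apply/mem_orthv/memv_pi.
Qed.

Definition altform_in U (m : nat) : set ({ffun 'I_m -> 'rV[R]_d} -> R) :=
  [set (fun w : {ffun 'I_m -> 'rV[R]_d} => a [ffun i => orth_proj U (w i)])
     | a in altform (subvs_of U) m].

(* For the standard orientation and inner product of R^d,
     (star a)(w) = \sum_I a(e_I) vol(e_I, w),
   where I ranges over the strictly increasing m-tuples of indices; since
   both factors are alternating in I, this is the sum over all m-tuples of
   indices divided by m!.  See hodge_star_dx. *)
Definition hodge_star (m n : nat) (emn : (m + n)%N = d)
    (a : {ffun 'I_m -> 'rV[R]_d} -> R) : {ffun 'I_n -> 'rV[R]_d} -> R :=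
  fun w => (m`!%:R)^-1 * \sum_(t : {ffun 'I_m -> 'I_d})
    a [ffun i => delta_mx 0 (t i)] *
    \det (castmx (emn, erefl d)
            (col_mx (\matrix_(i < m) delta_mx 0 (t i)) (\matrix_(i < n) w i))).

(* dx_(t 0) /\ ... /\ dx_(t (m - 1)) *)
Definition dx (m : nat) (t : 'I_m -> 'I_d) (w : {ffun 'I_m -> 'rV[R]_d}) : R :=
  \det (\matrix_(i < m, j < m) w i 0 (t j)).

Lemma sum_delta_ffun (m : nat) (F : {ffun 'I_m -> 'I_d} -> R)
    (g : {ffun 'I_m -> 'I_d}) :
  \sum_(t : {ffun 'I_m -> 'I_d}) F t * \prod_(i < m) (t i == g i)%:R = F g.
Proof.
rewrite (bigD1 g) //= big1 ?mulr1 => [|i _]; last by rewrite eqxx.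
rewrite big1 ?addr0 // => t /eqP tg; have [i ti] : exists i, t i != g i.
  apply/existsP; rewrite -negb_forall; apply/negP => /forallP tE.
  by apply: tg; apply/ffunP => i; apply/eqP.
by rewrite (bigD1 i) //= (negPf ti) mul0r mulr0.
Qed.

End AltForms.
Arguments altform {R} V k _.
Arguments altform_in {R d} U m _.

Lemma hodge_star_dx (R : realType) (d m n : nat) (emn : (m + n)%N = d)
    (s : 'S_d) :
  hodge_star emn (dx (R := R) (fun i => s (cast_ord emn (lshift n i)))) =
  fun w => (-1) ^+ s * dx (fun j => s (cast_ord emn (rshift m j))) w.
Proof.
subst d; apply/funext => w; rewrite /hodge_star /dx.
under eq_bigr => t _ do rewrite castmx_id.
pose A (t : {ffun 'I_m -> 'I_(m + n)}) : 'M[R]_m :=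
  \matrix_(i, j) (t i == s (lshift n j))%:R.
pose D : 'M[R]_n := \matrix_(i, j) w i 0 (s (rshift m j)).
have detA (t : {ffun 'I_m -> 'I_(m + n)}) : \det (\matrix_(i < m, j < m)
    ([ffun i0 => delta_mx 0 (t i0)] : {ffun 'I_m -> 'rV[R]_(m + n)}) i 0
      (s (cast_ord erefl (lshift n j)))) = \det (A t).
  by congr (\det _); apply/matrixP => i j; rewrite !mxE ffunE mxE cast_ord_id eq_sym.
have detD : \det (\matrix_(i < n, j < n) w i 0 (s (cast_ord erefl (rshift m j))))
    = \det D.
  by congr (\det _); apply/matrixP => i j; rewrite !mxE cast_ord_id.
rewrite detD (eq_bigr (fun t : {ffun 'I_m -> 'I_(m + n)} => (-1) ^+ s * \det D * (\det (A t) * \det (A t)))).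
  rewrite -mulr_sumr; suff -> : \sum_(t : {ffun 'I_m -> 'I_(m + n)}) \det (A t) * \det (A t) = m`!%:R.
    by rewrite mulrCA mulVf ?mulr1 // pnatr_eq0 -lt0n fact_gt0.
  under eq_bigr => t _ do rewrite {2}/determinant mulr_sumr.
  rewrite exchange_big /= (eq_bigr (fun=> 1)) => [|p _].
    by rewrite sumr_const card_Sn.
  pose g : {ffun 'I_m -> 'I_(m + n)} := [ffun i => s (lshift n (p i))].
  rewrite (eq_bigr (fun t : {ffun 'I_m -> 'I_(m + n)} => (\det (A t) * (-1) ^+ p) *
      \prod_(i < m) (t i == g i)%:R)) => [|t _].
    rewrite (sum_delta_ffun (fun t => \det (A t) * (-1) ^+ p)).
    have -> : A g = perm_mx p.
      apply/matrixP => i j; rewrite !mxE ffunE.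
      by rewrite (inj_eq perm_inj) (inj_eq (@lshift_inj _ _)).
    by rewrite det_perm -signr_addb addbb.
  by rewrite mulrA; congr (_ * _); apply: eq_bigr => i _; rewrite mxE ffunE.
move=> t _; rewrite detA.
set M := col_mx _ _.
have Mu i j : M (lshift n i) j = (t i == j)%:R.
  by rewrite col_mxEu !mxE eqxx eq_sym.
have Md i j : M (rshift m i) j = w i 0 j by rewrite col_mxEd !mxE.
clearbody M.
have -> : \det M = (-1) ^+ s * \det (col_perm s M).
  by rewrite col_permE det_mulmx det_perm odd_permV mulrCA -signr_addb addbb mulr1.
have [->|A0] := eqVneq (\det (A t)) 0; first by rewrite !mul0r mulr0.
suff -> : col_perm s M = block_mx (A t) 0 (\matrix_(i, j) w i 0 (s (lshift n j))) D.
  by rewrite det_lblock mulrCA -!mulrA; congr (_ * _); rewrite mulrA mulrC.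
rewrite -[LHS]submxK; congr block_mx; apply/matrixP => i j.
- by rewrite !mxE Mu.
- rewrite !mxE Mu; case: eqP => // ti; case/eqP: A0.
  rewrite (expand_det_row _ i) big1 // => j' _.
  by rewrite mxE ti (inj_eq perm_inj) eq_rlshift mul0r.
- by rewrite !mxE Md.
- by rewrite !mxE Md.
Qed.

Section Simplex.
Variables (R : realType) (d : nat).
Variable v : 'I_d.+1 -> 'rV[R]_d.
Implicit Types (f : {set 'I_d.+1}) (x : 'rV[R]_d) (r k m : nat).

Definition affinely_independent : bool :=
  free [tuple v (lift ord0 i) - v ord0 | i < d].

Definition subsimplices (l : nat) : {set {set 'I_d.+1}} :=
  [set f : {set 'I_d.+1} | #|f| == l.+1]%SET.

Definition face f : set 'rV[R]_d :=
  [set x | exists w : 'I_d.+1 -> R,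
     [/\ forall i, 0 <= w i, \sum_(i in f) w i = 1
       & x = \sum_(i in f) w i *: v i]].

Definition tangent f : {vspace 'rV[R]_d} :=
  <<[seq v i - v j | i <- enum f, j <- enum f]>>%VS.

Definition bary_mx : 'M[R]_(1 + d) :=
  \matrix_(i < 1 + d) row_mx 1 (v i).

(* The barycentric coordinates of x solve (1, x) = lambda *m bary_mx;
   see sum_bary and sum_baryZ. *)
Definition bary (i : 'I_d.+1) : {mpoly R[d]} :=
  (invmx bary_mx (lshift d 0) i)%:MP
  + \sum_(j < d) invmx bary_mx (rshift 1 j) i *: 'X_j.

Lemma bary_mxl i : bary_mx i (lshift d 0) = 1.
Proof. by rewrite mxE row_mxEl mxE eqxx. Qed.

Lemma bary_mxr i j : bary_mx i (rshift 1 j) = v i 0 j.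
Proof. by rewrite mxE row_mxEr. Qed.

Lemma bary_mx_unit : affinely_independent -> bary_mx \in unitmx.
Proof.
move=> /freeP Tf; rewrite -row_free_unit -kermx_eq0; apply/rowV0P => u.
move=> /sub_kermxP uM.
have u1 : \sum_i u 0 i = 0.
  have := congr1 (fun M : 'rV_(1 + d) => M 0 (lshift d 0)) uM.
  rewrite !mxE => /(etrans _); apply; apply: eq_bigr => i _.
  by rewrite bary_mxl mulr1.
have uv : \sum_(i < d.+1) u 0 i *: v i = 0.
  apply/rowP => j.
  have := congr1 (fun M : 'rV_(1 + d) => M 0 (rshift 1 j)) uM.
  rewrite !mxE summxE => /(etrans _); apply; apply: eq_bigr => i _.
  by rewrite mxE bary_mxr.
have u0 (i : 'I_d) : u 0 (lift ord0 i) = 0.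
  move: i; apply: Tf; move: u1 uv; rewrite !big_ord_recl => u1 uv.
  apply: etrans uv; rewrite (eq_bigr (fun i : 'I_d =>
    u 0 (lift ord0 i) *: v (lift ord0 i) - u 0 (lift ord0 i) *: v ord0)).
    2: by move=> i _; rewrite -tnth_nth tnth_mktuple scalerBr.
  rewrite sumrB -scaler_suml addrC -scaleNr; congr (_ *: _ + _).
  by apply/eqP; rewrite eq_sym -addr_eq0 u1.
apply/rowP => i; rewrite mxE; case: (unliftP ord0 i) => [j|] ->; first exact: u0.
move: u1; rewrite big_ord_recl big1 ?addr0 // => j _; exact: u0.
Qed.

Lemma meval_bary x i : (bary i).@[x 0] = (row_mx 1 x *m invmx bary_mx) 0 i.
Proof.
rewrite mxE big_split_ord /= big_ord_recl big_ord0 addr0 row_mxEl mxE mul1r.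
rewrite mevalD mevalC raddf_sum /=; congr (_ + _).
by apply: eq_bigr => j _; rewrite mevalZ mevalXU row_mxEr mulrC.
Qed.

Lemma sum_bary x : affinely_independent -> \sum_i (bary i).@[x 0] = 1.
Proof.
move=> /bary_mx_unit Tu.
have := congr1 (fun M : 'rV_(1 + d) => M 0 (lshift d 0)) (mulmxKV Tu (row_mx 1 x)).
rewrite mxE row_mxEl mxE eqxx => /(etrans _); apply.
by apply: eq_bigr => i _; rewrite meval_bary bary_mxl mulr1.
Qed.

Lemma sum_baryZ x : affinely_independent -> \sum_i (bary i).@[x 0] *: v i = x.
Proof.
move=> /bary_mx_unit Tu; apply/rowP => j.
have := congr1 (fun M : 'rV_(1 + d) => M 0 (rshift 1 j)) (mulmxKV Tu (row_mx 1 x)).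
rewrite mxE row_mxEr => /(etrans _); apply; rewrite summxE.
by apply: eq_bigr => i _; rewrite mxE meval_bary bary_mxr.
Qed.

Definition bubble f : {mpoly R[d]} := \prod_(i in f) bary i.

(* No exponent vector qualifies for m < 0, and the span is then {0}. *)
Definition face_poly f (m : int) : set {mpoly R[d]} :=
  span_set [set p | exists a : 'I_d.+1 -> nat,
    (\sum_(i in f) a i)%N%:Z = m /\ p = \prod_(i in f) bary i ^+ a i].

(* A k-form with polynomial coefficients is a map from k-tuples of vectors to
   polynomials; p (x) a is the form w |-> a(w) p. *)
Definition pform (k : nat) := {ffun 'I_k -> 'rV[R]_d} -> {mpoly R[d]}.

Definition tensor k (P : set {mpoly R[d]})
    (A : set ({ffun 'I_k -> 'rV[R]_d} -> R)) : set (pform k) :=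
  span_set [set ((fun w => a w *: p) : pform k) | p in P & a in A].

Definition poly_le (r : nat) : set {mpoly R[d]} := [set p | (msize p <= r.+1)%N].

Definition poly_forms r k : set (pform k) :=
  tensor (poly_le r) (altform 'rV[R]_d k).

Definition face_trace k f (w : pform k)
    (x : {x : 'rV[R]_d | face f x}) (t : {ffun 'I_k -> subvs_of (tangent f)}) :
    R :=
  (w [ffun i => vsval (t i)]).@[(sval x) 0].

Definition ker_boundary_trace k : set (pform k) :=
  [set w | forall F, F \in subsimplices d.-1 ->
             forall (x : {x | face F x}) t, @face_trace k F w x t = 0].

Definition bubble_summand r k (hk : (k <= d)%N) (l : nat) f : set (pform k) :=
  tensor [set q * bubble f | q in face_poly f (r%:Z - l.+1%:Z)]
         (hodge_star (subnK hk) @` altform_in (tangent f) (d - k)%N).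

Definition bubble_level r k (hk : (k <= d)%N) (l : nat) : set (pform k) :=
  sum_set (fun f => f \in subsimplices l) (bubble_summand r hk l).

Definition bubble_forms r k (hk : (k <= d)%N) : set (pform k) :=
  sum_set (fun l : 'I_d.+1 => (d - k <= l)%N) (fun l => bubble_level r hk l).

Definition bubble_forms_direct r k (hk : (k <= d)%N) : Prop :=
  direct_set (fun l : 'I_d.+1 => (d - k <= l)%N) (fun l => bubble_level r hk l)
  /\ forall l : 'I_d.+1, (d - k <= l)%N ->
       direct_set (fun f => f \in subsimplices l) (bubble_summand r hk l).

End Simplex.

Arguments poly_forms R d r k _ : clear implicits.
Arguments ker_boundary_trace {R d} v k _.

(* Main.v *)
(* Since r >= 1, the Bernstein monomials b_a (products of powers of the
   barycentric coordinates of total degree r) form a basis of the polynomials of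
   degree at most r, and each is a multiple of the bubble of exactly one nonempty
   subsimplex, its support supp a.  Hence a form is uniquely a sum of the b_a times
   alternating forms, and the sum over the subsimplices is direct.  On a facet F,
   the b_a with supp a inside F stay linearly independent and the others vanish,
   so the trace on F is zero iff each coefficient with supp a inside F vanishes
   on the tangent space of F.  It remains to see that a k-form vanishes on the
   tangent spaces of all facets containing f iff it is the Hodge star of a form on
   the tangent space of f.  The gradients n_i of the barycentric coordinates with
   i not in f span the orthogonal complement of that tangent space, and n_i is
   normal to the facet opposite to i; the star exchanges the forms killed by
   contraction with n_i and the forms that vanish on the hyperplane orthogonal to
   n_i.  The star is onto because its square is the identity up to sign. *)
Require Import Defs.
From mathcomp Require Import all_boot all_order all_algebra perm.
From mathcomp Require Import boolp classical_sets functions reals.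
From mathcomp Require Import mpoly zify.
Local Open Scope classical_set_scope.

Set Implicit Arguments.
Unset Strict Implicit.
Unset Printing Implicit Defensive.

Import Order.TTheory GRing.Theory Num.Theory.

(** * Alternating forms *)

Section Multilinear.
Local Open Scope ring_scope.
Variables (R : realType) (V : lmodType R).

(** A name for the update that [altform] spells out with [finfun] and [dfwith]; folding it back
    makes slotwise linearity usable for rewriting. *)
Definition upd k (v : {ffun 'I_k -> V}) (i : 'I_k) (x : V) : {ffun 'I_k -> V} :=
  finfun (dfwith v (i := i) x).

Lemma updE k (v : {ffun 'I_k -> V}) i x j :
  upd v i x j = if j == i then x else v j.
Proof.
rewrite ffunE; have [->|ji] := eqVneq j i; first by rewrite dfwith_in.
by rewrite dfwith_out // eq_sym.
Qed.

Lemma upd_id k (v : {ffun 'I_k -> V}) i : upd v i (v i) = v.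
Proof. by apply/ffunP => j; rewrite updE; case: eqP => // ->. Qed.

Definition multilinear k (a : {ffun 'I_k -> V} -> R) :=
  forall v i, scalar (fun x => a (upd v i x)).

Lemma altform_multilinear k (a : {ffun 'I_k -> V} -> R) :
  altform V k a -> multilinear a.
Proof. by case. Qed.

Section Theory.
Variables (k : nat) (a : {ffun 'I_k -> V} -> R).
Hypothesis a_lin : multilinear a.

Lemma multilinearD v i x y : a (upd v i (x + y)) = a (upd v i x) + a (upd v i y).
Proof. by have := a_lin v i 1 x y; rewrite scale1r mul1r. Qed.

Lemma multilinear0 v i : a (upd v i 0) = 0.
Proof. by apply: (addrI (a (upd v i 0))); rewrite -multilinearD !addr0. Qed.

Lemma multilinearZ v i c x : a (upd v i (c *: x)) = c * a (upd v i x).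
Proof. by have := a_lin v i c x 0; rewrite !addr0 multilinear0 addr0. Qed.

Lemma multilinearB v i x y : a (upd v i (x - y)) = a (upd v i x) - a (upd v i y).
Proof. by rewrite multilinearD -scaleN1r multilinearZ mulN1r. Qed.

Lemma multilinear_sum v i (I : finType) (c : I -> R) (x : I -> V) :
  a (upd v i (\sum_l c l *: x l)) = \sum_l c l * a (upd v i (x l)).
Proof.
elim/big_rec2: _ => [|l y z _ IH]; first exact: multilinear0.
by rewrite multilinearD multilinearZ IH.
Qed.

(** The entries of [x] are exchanged for those of [y] one slot at a time; each exchange changes the
    value by a term with an argument in [N]. *)
Lemma multilinear_congr (N : V -> Prop) (x y : {ffun 'I_k -> V}) :
  (forall z j n, N n -> a (upd z j n) = 0) -> (forall j, N (x j - y j)) ->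
  a x = a y.
Proof.
move=> aN xyN.
pose z (p : nat) : {ffun 'I_k -> V} := [ffun j : 'I_k => if (j < p)%N then y j else x j].
have zS p : (p <= k)%N -> a x = a (z p).
  elim: p => [_|p IH pk]; first by congr a; apply/ffunP => j; rewrite ffunE ltn0.
  rewrite IH 1?ltnW //; pose i := Ordinal pk.
  have -> : z p = upd (z p) i (x i).
    apply/ffunP => j; rewrite updE; case: eqP => // ->.
    by rewrite ffunE ltnn.
  have -> : z p.+1 = upd (z p) i (y i).
    apply/ffunP => j; rewrite updE; case: eqP => [->|/eqP ji].
      by rewrite ffunE ltnSn.
    rewrite !ffunE ltnS leq_eqVlt; case: eqP => // jp.
    by case/eqP: ji; apply: val_inj.
  by apply/eqP; rewrite -subr_eq0 -multilinearB aN.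
by rewrite (zS k) //; congr a; apply/ffunP => j; rewrite ffunE ltn_ord.
Qed.

End Theory.

Definition vcons k (x : V) (v : {ffun 'I_k -> V}) : {ffun 'I_k.+1 -> V} :=
  [ffun j => oapp v x (unlift ord0 j)].

(** Induction on [k]: slot 0 is expanded by linearity, the other slots by the induction hypothesis
    for [a] with slot 0 frozen. *)
Lemma multilinear_expand k (a : {ffun 'I_k -> V} -> R) (I : finType)
    (x : I -> V) (c : 'I_k -> I -> R) :
  multilinear a ->
  a [ffun j => \sum_i c j i *: x i] =
  \sum_(t : {ffun 'I_k -> I}) (\prod_j c j (t j)) * a [ffun j => x (t j)].
Proof.
elim: k a c => [|k IH] a c a_lin.
  pose t0 : {ffun 'I_0 -> I} := ffun0 (card_ord 0).
  rewrite (bigD1 t0) //= big_ord0 mul1r [X in _ + X]big1 ?addr0 => [|t].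
    by congr a; apply/ffunP => -[].
  by move=> /eqP[]; apply/ffunP => -[].
have updl (v : {ffun 'I_k -> V}) y i z :
    upd (vcons y v) (lift ord0 i) z = vcons y (upd v i z).
  apply/ffunP => j; rewrite updE !ffunE; case: unliftP => [l|] -> //=.
  by rewrite updE (inj_eq lift_inj).
have upd0 (v : {ffun 'I_k -> V}) z : vcons z v = upd (vcons 0 v) ord0 z.
  by apply/ffunP => j; rewrite updE !ffunE; case: unliftP => [l|] -> //=.
have -> : [ffun j => \sum_i c j i *: x i] = vcons (\sum_i c ord0 i *: x i)
    [ffun j => \sum_i c (lift ord0 j) i *: x i].
  by apply/ffunP => j; rewrite !ffunE; case: unliftP => [l|] -> //=; rewrite ffunE.
rewrite upd0 multilinear_sum //.
under eq_bigr => i _.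
  rewrite -upd0 (IH (fun v => a (vcons (x i) v))); last first.
    by move=> v j e y z; rewrite -!updl; apply: a_lin.
  rewrite mulr_sumr; over.
pose h (p : I * {ffun 'I_k -> I}) : {ffun 'I_k.+1 -> I} :=
  [ffun j => oapp p.2 p.1 (unlift ord0 j)].
have hb : bijective h.
  exists (fun t : {ffun 'I_k.+1 -> I} =>
    (t ord0, [ffun j => t (lift ord0 j)] : {ffun 'I_k -> I})) => [[i t]|t].
    rewrite /h ffunE unlift_none; congr pair; apply/ffunP => j.
    by rewrite !ffunE liftK.
  by apply/ffunP => j; rewrite ffunE; case: unliftP => [l|] -> //=; rewrite ffunE.
rewrite pair_bigA [RHS](reindex h) /=; last exact: onW_bij.
apply: eq_bigr => -[i t] _ /=; rewrite mulrA; congr (_ * a _).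
  rewrite big_ord_recl ffunE unlift_none; congr (_ * _).
  by apply: eq_bigr => j _; rewrite ffunE liftK.
by apply/ffunP => j; rewrite !ffunE; case: unliftP => [l|] _ //=; rewrite ffunE.
Qed.

(** Polarization: putting [v i + v j] in both slots [i] and [j] gives 0, and after expansion only
    the two mixed terms survive. *)
Lemma altform_tperm k (a : {ffun 'I_k -> V} -> R) (v : {ffun 'I_k -> V})
    (i j : 'I_k) :
  altform V k a -> i != j -> a [ffun l => v (tperm i j l)] = - a v.
Proof.
move=> [a_lin a_alt] ij; have {}a_lin : multilinear a by [].
pose D x y := a (upd (upd v i x) j y).
have DD x : D x x = 0.
  by apply: (a_alt _ i j) => //; rewrite !updE eqxx (negPf ij) eqxx.
have swap x y : upd (upd v i x) j y = upd (upd v j y) i x.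
  apply/ffunP => l; rewrite !updE; case: eqP => [->|//].
  by rewrite eq_sym (negPf ij).
have Dl x y z : D (x + y) z = D x z + D y z.
  by rewrite /D !(swap _ z) multilinearD.
have DE : D (v i + v j) (v i + v j) = D (v i) (v j) + D (v j) (v i).
  by rewrite Dl /D !multilinearD // -!/(D _ _) !DD add0r addr0.
rewrite DD in DE.
have -> : a v = D (v i) (v j) by rewrite /D upd_id upd_id.
have -> : a [ffun l => v (tperm i j l)] = D (v j) (v i).
  congr a; apply/ffunP => l; rewrite !updE ffunE.
  by case: tpermP => [->|->|/eqP/negPf-> /eqP/negPf->]; rewrite ?eqxx ?(negPf ij).
by apply/eqP; rewrite -addr_eq0 addrC -DE.
Qed.

Lemma altform_perm k (a : {ffun 'I_k -> V} -> R) (v : {ffun 'I_k -> V})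
    (s : 'S_k) :
  altform V k a -> a [ffun l => v (s l)] = (-1) ^+ s * a v.
Proof.
move=> a_alt; have [ts -> {s}] := prod_tpermP s.
elim: ts v => [|[i j] ts IH] v /=.
  rewrite big_nil odd_perm1 mul1r => _; congr a.
  by apply/ffunP => l; rewrite ffunE perm1.
case/andP=> ij tsP; rewrite big_cons odd_mul_tperm ij addTb signrN mulNr.
have := IH v tsP; set s := (\prod_(t <- ts) _)%g => IHv.
rewrite -IHv -(altform_tperm _ a_alt ij); congr a; apply/ffunP => l.
by rewrite !ffunE permM.
Qed.

Lemma altform_lin k (c : R) (a b : {ffun 'I_k -> V} -> R) :
  altform V k a -> altform V k b -> altform V k (fun w => c * a w + b w).
Proof.
move=> [al aa] [bl ba]; split=> [v i e x y|v i j ij vij]; last first.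
  by rewrite (aa _ i j) // (ba _ i j) // mulr0 addr0.
by rewrite (al v i e x y) (bl v i e x y) !mulrDr !mulrA (mulrC c) addrACA.
Qed.

Lemma altform_ext k (a b : {ffun 'I_k -> V} -> R) :
  a =1 b -> altform V k a -> altform V k b.
Proof. by move/funext ->. Qed.

Lemma altform0 k : altform V k (fun=> 0).
Proof. by split=> // v i e x y; rewrite mulr0 addr0. Qed.

Lemma altform_sum k (I : finType) (P : pred I) (c : I -> R)
    (a : I -> {ffun 'I_k -> V} -> R) :
  (forall i, P i -> altform V k (a i)) ->
  altform V k (fun w => \sum_(i | P i) c i * a i w).
Proof.
move=> aP.
have H (s : seq I) : altform V k (fun w => \sum_(i <- s | P i) c i * a i w).
  elim: s => [|i s IH].
    by apply: altform_ext (altform0 k) => w; rewrite big_nil.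
  case Pi: (P i); last by apply: altform_ext IH => w; rewrite big_cons Pi.
  by apply: altform_ext (altform_lin (c i) (aP i Pi) IH) => w; rewrite big_cons Pi.
exact: H.
Qed.

Lemma altformZ k c (a : {ffun 'I_k -> V} -> R) :
  altform V k a -> altform V k (fun w => c * a w).
Proof.
move=> aa; apply: altform_ext (altform_lin c aa (altform0 k)) => w.
by rewrite addr0.
Qed.

End Multilinear.

(** * The Hodge star and orthogonal projections *)

Section Hodge.
Local Open Scope ring_scope.
Variables (R : realType) (d : nat).
Implicit Types (U : {vspace 'rV[R]_d}).

Definition std_tuple k (t : {ffun 'I_k -> 'I_d}) : {ffun 'I_k -> 'rV[R]_d} :=
  [ffun i => delta_mx 0 (t i)].

Lemma multilinear_std k (a : {ffun 'I_k -> 'rV[R]_d} -> R) w :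
  multilinear a ->
  a w = \sum_(t : {ffun 'I_k -> 'I_d}) (\prod_i w i 0 (t i)) * a (std_tuple t).
Proof.
move=> a_lin; rewrite -(multilinear_expand _ (fun i j => w i 0 j)) //.
by congr a; apply/ffunP => i; rewrite ffunE -row_sum_delta.
Qed.

Lemma std_tuple_injP k (a : {ffun 'I_k -> 'rV[R]_d} -> R) (t : {ffun 'I_k -> 'I_d}) :
  altform 'rV[R]_d k a -> a (std_tuple t) != 0 -> injective t.
Proof.
move=> [_ a_alt] + i j tij; apply: contra_neq_eq => ij.
by apply: (a_alt _ i j) => //; rewrite !ffunE tij.
Qed.

(** The sum runs over all tuples, not only the increasing ones, hence the division by k!: each of
    the k! permutations in the determinant contributes one copy of [a w]. *)
Lemma altform_dx k (a : {ffun 'I_k -> 'rV[R]_d} -> R) w :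
  altform 'rV[R]_d k a ->
  a w = \sum_(t : {ffun 'I_k -> 'I_d}) (k`!%:R^-1 * a (std_tuple t)) * dx t w.
Proof.
move=> a_alt; under eq_bigr do rewrite -mulrA.
rewrite -mulr_sumr /dx /determinant.
under eq_bigr do rewrite mulr_sumr.
rewrite exchange_big /= (eq_bigr (fun=> a w)) => [|s _].
  rewrite sumr_const card_Sn -[a w *+ _]mulr_natl mulKf //.
  by rewrite pnatr_eq0 -lt0n fact_gt0.
(* Undoing [s] in the index tuple draws the sign of [s] out of [a], which cancels the sign in the
   determinant. *)
pose h (t : {ffun 'I_k -> 'I_d}) : {ffun 'I_k -> 'I_d} := [ffun i => t (s^-1%g i)].
have hb : bijective h.
  exists (fun t : {ffun 'I_k -> 'I_d} => [ffun i => t (s i)] : {ffun 'I_k -> 'I_d}).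
    by move=> t; apply/ffunP => i; rewrite !ffunE permK.
  by move=> t; apply/ffunP => i; rewrite !ffunE permKV.
rewrite (reindex h) /=; last exact: onW_bij.
rewrite (multilinear_std _ (altform_multilinear a_alt)); apply: eq_bigr => t _.
have -> : std_tuple (h t) = [ffun i => std_tuple t (s^-1%g i)].
  by apply/ffunP => i; rewrite !ffunE.
rewrite altform_perm // odd_permV mulrACA -signr_addb addbb mul1r mulrC.
by congr (_ * _); apply: eq_bigr => i _; rewrite mxE ffunE permK.
Qed.

Definition tuple_det (z : {ffun 'I_d -> 'rV[R]_d}) : R := \det (\matrix_(i < d) z i).

Lemma tuple_det_alt : altform 'rV[R]_d d tuple_det.
Proof.
split=> [v i c x y|v i j ij vij]; last first.
  by apply: (determinant_alternate ij) => l; rewrite !mxE vij.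
rewrite -[X in _ = _ + X]mul1r -!/(upd _ _ _).
apply: (determinant_multilinear (i0 := i)).
- by rewrite !rowK !updE eqxx scale1r.
- by apply/matrixP => l j; rewrite !mxE !updE eq_sym (negPf (neq_lift _ _)).
- by apply/matrixP => l j; rewrite !mxE !updE eq_sym (negPf (neq_lift _ _)).
Qed.

(** The matrix with rows [z i] sends the nonzero column [n^T] to 0, so it is not invertible. *)
Lemma tuple_det_orth (n : 'rV[R]_d) (z : {ffun 'I_d -> 'rV[R]_d}) :
  n != 0 -> (forall i, dotv n (z i) = 0) -> tuple_det z = 0.
Proof.
move=> n0 nz; apply/eqP/negPn/negP => det0; case/eqP: n0; apply: trmx_inj.
have Mu : \matrix_(i < d) z i \in unitmx by rewrite unitmxE unitfE.
rewrite -[n^T](mulKmx Mu) trmx0 (_ : _ *m n^T = 0) ?mulmx0 //.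
apply/matrixP => i j; rewrite !mxE -[RHS](nz i) /dotv.
by apply: eq_bigr => l _; rewrite !mxE mulrC ord1.
Qed.

(** * The volume form on concatenated tuples *)

Section Vol.
Variables (m n : nat) (emn : (m + n)%N = d).

Definition cat_tuple (x : {ffun 'I_m -> 'rV[R]_d}) (w : {ffun 'I_n -> 'rV[R]_d}) :
    {ffun 'I_d -> 'rV[R]_d} :=
  [ffun i => match fintype.split (cast_ord (esym emn) i) with
             | inl j => x j | inr j => w j end].

Lemma cat_tuplel x w i : cat_tuple x w (cast_ord emn (lshift n i)) = x i.
Proof. by rewrite ffunE cast_ordK (unsplitK (inl _ i)). Qed.

Lemma cat_tupler x w j : cat_tuple x w (cast_ord emn (rshift m j)) = w j.
Proof. by rewrite ffunE cast_ordK (unsplitK (inr _ j)). Qed.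

Lemma cat_ordP (i : 'I_d) :
  (exists j, i = cast_ord emn (lshift n j)) \/
  (exists j, i = cast_ord emn (rshift m j)).
Proof.
rewrite -(cast_ordKV emn i).
by case: (split_ordP (cast_ord (esym emn) i)) => j ->; [left|right]; exists j.
Qed.

Lemma cat_tuple_updl x w i y :
  cat_tuple (upd x i y) w = upd (cat_tuple x w) (cast_ord emn (lshift n i)) y.
Proof.
apply/ffunP => j; rewrite updE; case: (cat_ordP j) => -[l ->].
  by rewrite !cat_tuplel updE (inj_eq (@cast_ord_inj _ _ emn)) eq_lshift.
by rewrite !cat_tupler (inj_eq (@cast_ord_inj _ _ emn)) eq_rlshift.
Qed.

Lemma cat_tuple_updr x w i y :
  cat_tuple x (upd w i y) = upd (cat_tuple x w) (cast_ord emn (rshift m i)) y.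
Proof.
apply/ffunP => j; rewrite updE; case: (cat_ordP j) => -[l ->].
  by rewrite !cat_tuplel (inj_eq (@cast_ord_inj _ _ emn)) eq_lrshift.
by rewrite !cat_tupler updE (inj_eq (@cast_ord_inj _ _ emn)) eq_rshift.
Qed.

Definition vol x w : R := tuple_det (cat_tuple x w).

Lemma vol_altr x : altform 'rV[R]_d n (vol x).
Proof.
have [dl da] := tuple_det_alt; split=> [w i|w i j ij wij].
  move=> c y z; rewrite -!/(upd _ _ _) /vol !cat_tuple_updr; exact: dl.
apply: (da _ (cast_ord emn (rshift m i)) (cast_ord emn (rshift m j))).
  by rewrite (inj_eq (@cast_ord_inj _ _ emn)) eq_rshift.
by rewrite !cat_tupler.
Qed.

Lemma vol_linl w : multilinear (fun x => vol x w).
Proof.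
by move=> x i c y z; rewrite /vol !cat_tuple_updl; apply: tuple_det_alt.1.
Qed.

Lemma hodge_starE (a : {ffun 'I_m -> 'rV[R]_d} -> R) w :
  hodge_star emn a w =
  (m`!%:R)^-1 * \sum_t a (std_tuple t) * vol (std_tuple t) w.
Proof.
congr (_ * _); apply: eq_bigr => t _; congr (_ * \det _).
apply/matrixP => i j; rewrite mxE castmxE cast_ord_id !mxE ffunE.
by case: fintype.split => l; rewrite !mxE ?ffunE ?mxE.
Qed.

Lemma hodge_star_alt (a : {ffun 'I_m -> 'rV[R]_d} -> R) :
  altform 'rV[R]_d n (hodge_star emn a).
Proof.
apply: altform_ext (altformZ (m`!%:R)^-1
  (altform_sum (fun t => a (std_tuple t)) (fun t _ => vol_altr (std_tuple t)))) => w.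
by rewrite hodge_starE.
Qed.

Lemma hodge_star_sum (I : finType) (c : I -> R)
    (A : I -> {ffun 'I_m -> 'rV[R]_d} -> R) w :
  hodge_star emn (fun x => \sum_(i : I) c i * A i x) w =
  \sum_i c i * hodge_star emn (A i) w.
Proof.
rewrite hodge_starE; under eq_bigr do rewrite mulr_suml.
rewrite exchange_big mulr_sumr; apply: eq_bigr => i _ /=.
rewrite hodge_starE mulrCA; congr (_ * _); rewrite mulr_sumr.
by apply: eq_bigr => t _; rewrite mulrA.
Qed.

Lemma hodge_starZ (c : R) (A : {ffun 'I_m -> 'rV[R]_d} -> R) w :
  hodge_star emn (fun x => c * A x) w = c * hodge_star emn A w.
Proof.
rewrite !hodge_starE mulrCA; congr (_ * _); rewrite mulr_sumr.
by apply: eq_bigr => t _; rewrite mulrA.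
Qed.

(** The first [m] positions are filled with an enumeration of the indices missed by [s]. This lets
    [hodge_star_dx], which is stated for a full permutation, be applied to [dx s]. *)
Lemma perm_extend (s : 'I_n -> 'I_d) : injective s ->
  exists p : 'S_d, forall j, p (cast_ord emn (rshift m j)) = s j.
Proof.
move=> s_inj; have cC : #|~: [set s j | j : 'I_n]| = m.
  by apply/eqP; rewrite -(eqn_add2l #|[set s j | j : 'I_n]|) cardsC
    card_imset // !card_ord addnC emn.
pose g (i : 'I_d) := match fintype.split (cast_ord (esym emn) i) with
  | inl j => enum_val (cast_ord (esym cC) j) | inr j => s j end.
have gl j : g (cast_ord emn (lshift n j)) = enum_val (cast_ord (esym cC) j).
  by rewrite /g cast_ordK (unsplitK (inl _ j)).
have gr j : g (cast_ord emn (rshift m j)) = s j.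
  by rewrite /g cast_ordK (unsplitK (inr _ j)).
have glr i j : enum_val (cast_ord (esym cC) i) != s j.
  have := enum_valP (cast_ord (esym cC) i); rewrite inE; apply: contraNneq => ->.
  exact: imset_f.
have g_inj : injective g.
  move=> i j; case: (cat_ordP i) => -[i' ->]; case: (cat_ordP j) => -[j' ->].
  - by rewrite !gl => /enum_val_inj/cast_ord_inj ->.
  - by rewrite gl gr => /eqP; rewrite (negPf (glr _ _)).
  - by rewrite gl gr => /esym/eqP; rewrite (negPf (glr _ _)).
  - by rewrite !gr => /s_inj ->.
by exists (perm g_inj) => j; rewrite permE gr.
Qed.

End Vol.

(** By [altform_dx] it suffices to treat [dx t] with [t] injective; such a [t] extends to a
    permutation, and [hodge_star_dx] applies twice. The sign is chosen before [a], as it depends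
    only on the two degrees. *)
Lemma hodge_starK m n (emn : (m + n)%N = d) (enm : (n + m)%N = d) :
  exists e : bool, forall a : {ffun 'I_n -> 'rV[R]_d} -> R,
    altform 'rV[R]_d n a ->
    forall w, hodge_star emn (hodge_star enm a) w = (-1) ^+ e * a w.
Proof.
(* Exchange of the block of [m] indices with the block of [n] indices; its parity is the sign
   sought. *)
pose g (i : 'I_d) : 'I_d := match fintype.split (cast_ord (esym enm) i) with
  | inl j => cast_ord emn (rshift m j) | inr j => cast_ord emn (lshift n j) end.
have gl j : g (cast_ord enm (lshift m j)) = cast_ord emn (rshift m j).
  by rewrite /g cast_ordK (unsplitK (inl _ j)).
have gr j : g (cast_ord enm (rshift n j)) = cast_ord emn (lshift n j).
  by rewrite /g cast_ordK (unsplitK (inr _ j)).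
have g_inj : injective g.
  move=> i j; case: (cat_ordP enm i) => -[i' ->]; case: (cat_ordP enm j) => -[j' ->].
  - by rewrite !gl => /cast_ord_inj/rshift_inj ->.
  - by rewrite gl gr => /cast_ord_inj/eqP; rewrite eq_rlshift.
  - by rewrite gl gr => /cast_ord_inj/eqP; rewrite eq_lrshift.
  - by rewrite !gr => /cast_ord_inj/lshift_inj ->.
pose q := perm g_inj; exists q => a a_alt w.
(* The two stars contribute the signs of [q * p] and of [p], so the sign of [p] cancels. *)
have starDx (p : 'S_d) (t : 'I_n -> 'I_d) u :
    (forall j, p (cast_ord emn (rshift m j)) = t j) ->
    hodge_star emn (hodge_star enm (dx t)) u = (-1) ^+ q * dx (R := R) t u.
  move=> pt; have -> : dx (R := R) t =
      dx (fun i => (q * p)%g (cast_ord enm (lshift m i))).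
    by congr dx; apply/funext => j; rewrite permM permE gl pt.
  rewrite hodge_star_dx hodge_starZ odd_permM signr_addb -mulrA; congr (_ * _).
  have -> : dx (fun j => (q * p)%g (cast_ord enm (rshift n j))) =
      dx (R := R) (fun i => p (cast_ord emn (lshift n i))).
    by congr dx; apply/funext => j; rewrite permM permE gr.
  rewrite hodge_star_dx mulrA -signr_addb addbb mul1r; congr dx.
  by apply/funext => j; rewrite permM permE gl.
have -> : a = fun x =>
    \sum_(t : {ffun 'I_n -> 'I_d}) (n`!%:R^-1 * a (std_tuple t)) * dx t x.
  by apply/funext => x; apply: altform_dx.
have -> : hodge_star enm (fun x => \sum_(t : {ffun 'I_n -> 'I_d})
      (n`!%:R^-1 * a (std_tuple t)) * dx t x) =
    fun x => \sum_(t : {ffun 'I_n -> 'I_d})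
      (n`!%:R^-1 * a (std_tuple t)) * hodge_star enm (dx t) x.
  by apply/funext => x; apply: hodge_star_sum.
rewrite hodge_star_sum big_distrr; apply: eq_bigr => t _ /=.
have [->|/(std_tuple_injP a_alt) t_inj] := eqVneq (a (std_tuple t)) 0.
  by rewrite !mulr0 !mul0r mulr0.
by have [p pt] := perm_extend emn t_inj; rewrite (starDx p) // mulrCA.
Qed.

(** A symmetric map moves from the arguments of one factor to those of the other: expanded in the
    standard basis, both sides are the same double sum. *)
Lemma sum_std_adjoint k (A B : {ffun 'I_k -> 'rV[R]_d} -> R)
    (p : 'rV[R]_d -> 'rV[R]_d) :
  multilinear A -> multilinear B ->
  (forall i j, p (delta_mx 0 i) 0 j = p (delta_mx 0 j) 0 i) ->
  \sum_(t : {ffun 'I_k -> 'I_d}) A [ffun i => p (std_tuple t i)] * B (std_tuple t) =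
  \sum_(t : {ffun 'I_k -> 'I_d}) A (std_tuple t) * B [ffun i => p (std_tuple t i)].
Proof.
move=> A_lin B_lin p_sym.
under eq_bigr do rewrite (multilinear_std _ A_lin) mulr_suml.
rewrite exchange_big /=; apply: eq_bigr => t _.
rewrite (multilinear_std _ B_lin) mulr_sumr; apply: eq_bigr => s _.
rewrite [RHS]mulrCA mulrA; congr (_ * _ * _).
by apply: eq_bigr => i _; rewrite !ffunE p_sym.
Qed.

(** * Orthogonal projections and forms on a subspace *)

Definition proj U (x : 'rV[R]_d) : 'rV[R]_d := vsval (orth_proj U x).

Lemma proj_in U x : proj U x \in U.
Proof. exact: subvsP. Qed.

Lemma proj_orth U x u : u \in U -> dotv u (x - proj U x) = 0.
Proof. exact: orth_projP. Qed.

Lemma dotv_proj U x u : u \in U -> dotv u (proj U x) = dotv u x.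
Proof.
move=> /(proj_orth x)/eqP; rewrite dotvD -scaleN1r dotvZ mulN1r subr_eq0.
by move=> /eqP.
Qed.

Lemma dotv_delta (x : 'rV[R]_d) j : dotv x (delta_mx 0 j) = x 0 j.
Proof.
rewrite /dotv (bigD1 j) //= mxE !eqxx mulr1 big1 ?addr0 // => i ij.
by rewrite mxE (negPf ij) andbF mulr0.
Qed.

(** Both entries equal the inner product of the two projected basis vectors. *)
Lemma proj_sym U i j : proj U (delta_mx 0 i) 0 j = proj U (delta_mx 0 j) 0 i.
Proof.
rewrite -!dotv_delta -(dotv_proj _ (proj_in U _)) dotvC.
by rewrite (dotv_proj _ (proj_in U _)).
Qed.

Lemma proj_id U u : u \in U -> proj U u = u.
Proof.
move=> uU; rewrite /proj /orth_proj daddv_pi_id ?vsprojK //; exact: capv_orthv.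
Qed.

(** Describes pulled-back forms without the subtype [subvs_of U]. In the converse, the form on [U]
    is the restriction of [b]. *)
Lemma altform_inP U m (b : {ffun 'I_m -> 'rV[R]_d} -> R) :
  altform_in U m b <->
  altform 'rV[R]_d m b /\ forall w, b w = b [ffun i => proj U (w i)].
Proof.
split=> [[a [a_lin a_alt] <-{b}]|[[b_lin b_alt] bP]].
  split=> [|w]; last first.
    congr a; apply/ffunP => i; rewrite !ffunE; apply: val_inj => /=.
    by rewrite -[LHS]/(proj U _) -[RHS]/(proj U _) (proj_id (proj_in U _)).
  have pu (w : {ffun 'I_m -> 'rV[R]_d}) i x :
      [ffun j => orth_proj U (upd w i x j)] =
      upd [ffun j => orth_proj U (w j)] i (orth_proj U x).
    by apply/ffunP => j; rewrite ffunE !updE ffunE; case: eqP.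
  split=> [w i c x y|w i j ij wij]; last first.
    by apply: (a_alt _ i j) => //; rewrite !ffunE wij.
  rewrite -!/(upd _ _ _) !pu -(a_lin _ i c) -!/(upd _ _ _).
  by rewrite /orth_proj !linearP.
exists (fun t : {ffun 'I_m -> subvs_of U} => b [ffun i => vsval (t i)]).
  have vu (t : {ffun 'I_m -> subvs_of U}) i x :
      [ffun j => vsval (upd t i x j)] = upd [ffun j => vsval (t j)] i (vsval x).
    by apply/ffunP => j; rewrite ffunE !updE ffunE; case: eqP.
  split=> [t i c x y|t i j ij tij]; last first.
    by apply: (b_alt _ i j) => //; rewrite !ffunE tij.
  by rewrite -!/(upd _ _ _) !vu linearP; apply: b_lin.
apply/funext => w; rewrite [RHS]bP; congr (b _).
by apply/ffunP => i; rewrite !ffunE.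
Qed.

End Hodge.

(** * Tangent spaces of subsimplices *)

Section Barycentric.
Local Open Scope ring_scope.
Variables (R : realType) (d : nat) (v : 'I_d.+1 -> 'rV[R]_d).
Hypothesis v_indep : affinely_independent v.
Implicit Types (f : {set 'I_d.+1}) (c : 'I_d.+1 -> R) (x : 'rV[R]_d).

(** With [s] equal to 1 this gives the barycentric coordinates of a point, with [s] equal to 0 those
    of a direction, such as a difference of vertices. *)
Lemma bary_mx_coord (s : 'rV[R]_1) c x :
  \sum_i c i = s 0 0 -> x = \sum_i c i *: v i ->
  row_mx s x *m invmx (bary_mx v) = \row_i c i.
Proof.
move=> cs ->; rewrite -[RHS](mulmxK (bary_mx_unit v_indep)); congr (_ *m _).
apply/rowP => j; rewrite [RHS]mxE; case: (split_ordP j) => l ->.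
  rewrite row_mxEl !ord1 -cs; apply: eq_bigr => i _.
  by rewrite bary_mxl mxE mulr1.
rewrite row_mxEr summxE; apply: eq_bigr => i _.
by rewrite bary_mxr !mxE.
Qed.

Lemma meval_bary_comb c i :
  \sum_j c j = 1 -> (bary v i).@[(\sum_j c j *: v j) 0] = c i.
Proof.
move=> c1; rewrite meval_bary (bary_mx_coord (c := c)) ?mxE //.
Qed.

Definition bary_grad i : 'rV[R]_d := \row_j invmx (bary_mx v) (rshift 1 j) i.

Lemma dotv_grad i x : dotv (bary_grad i) x = (row_mx 0 x *m invmx (bary_mx v)) 0 i.
Proof.
rewrite mxE big_split_ord /= big_ord_recl big_ord0 row_mxEl mxE mul0r !add0r.
by apply: eq_bigr => j _; rewrite row_mxEr mxE mulrC.
Qed.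

Lemma dotv_grad_vertices i a b :
  dotv (bary_grad i) (v a - v b) = (i == a)%:R - (i == b)%:R.
Proof.
rewrite dotv_grad (bary_mx_coord (c := fun i => (i == a)%:R - (i == b)%:R)).
- by rewrite mxE.
- rewrite sumrB (bigD1 a) //= eqxx big1 => [|j /negPf -> //].
  rewrite (bigD1 b) //= eqxx big1 => [|j /negPf -> //].
  by rewrite !addr0 subrr mxE.
- under eq_bigr do rewrite scalerBl; rewrite sumrB.
  rewrite (bigD1 a) //= eqxx big1 => [|j /negPf ->]; last by rewrite scale0r.
  rewrite (bigD1 b) //= eqxx big1 => [|j /negPf ->]; last by rewrite scale0r.
  by rewrite !addr0 !scale1r.
Qed.

Lemma sum_grad x : \sum_i dotv (bary_grad i) x = 0.
Proof.
have := congr1 (fun M : 'rV_(1 + d) => M 0 (lshift d 0))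
  (mulmxKV (bary_mx_unit v_indep) (row_mx 0 x)).
rewrite mxE row_mxEl mxE => /(etrans _); apply; apply: eq_bigr => i _.
by rewrite dotv_grad bary_mxl mulr1.
Qed.

Lemma sum_gradZ x : x = \sum_i dotv (bary_grad i) x *: v i.
Proof.
apply/rowP => j.
have := congr1 (fun M : 'rV_(1 + d) => M 0 (rshift 1 j))
  (mulmxKV (bary_mx_unit v_indep) (row_mx 0 x)).
rewrite mxE row_mxEr => <-; rewrite summxE; apply: eq_bigr => i _.
by rewrite [RHS]mxE dotv_grad bary_mxr.
Qed.

Lemma sum_grad_edges x i0 :
  x = \sum_i dotv (bary_grad i) x *: (v i - v i0).
Proof.
under eq_bigr do rewrite scalerBr.
by rewrite sumrB -scaler_suml sum_grad scale0r subr0 -sum_gradZ.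
Qed.

(** The gradients of vertices outside [f] are orthogonal to every edge of [f]; conversely, if they
    annihilate [x], the expansion of [x] in edges from [i0] involves only edges of [f]. *)
Lemma mem_tangent f i0 x : i0 \in f ->
  reflect (forall i, i \notin f -> dotv (bary_grad i) x = 0) (x \in tangent v f).
Proof.
move=> i0f; apply: (iffP idP) => [xf i fi|x0].
  have /subvP/(_ x xf)/mem_orthv : (tangent v f <= orthv <[bary_grad i]>)%VS.
    apply/span_subvP => _ /allpairsP[[a b] /= [af bf ->]].
    apply/mem_orthv => _ /vlineP[c ->].
    rewrite dotvC dotvZ dotvC dotv_grad_vertices.
    case: (eqVneq i a) => [ia|_]; first by rewrite ia -mem_enum af in fi.
    case: (eqVneq i b) => [ib|_]; first by rewrite ib -mem_enum bf in fi.
    by rewrite subrr mulr0.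
  by apply; apply: memv_line.
rewrite (sum_grad_edges x i0); apply: memv_suml => i _.
have [fi|/x0 ->] := boolP (i \in f); last by rewrite scale0r mem0v.
by apply/memvZ/memv_span/allpairs_f; rewrite mem_enum.
Qed.

Lemma bary_grad_neq0 i : (0 < d)%N -> bary_grad i != 0.
Proof.
move=> d0; have := dotv_grad_vertices i i (lift i (Ordinal d0)).
rewrite eqxx (negPf (neq_lift _ _)) subr0 => E; apply/eqP => g0.
by move: E; rewrite g0 dotvC dotv0 => /esym/eqP; rewrite oner_eq0.
Qed.

Definition normals f : {vspace 'rV[R]_d} :=
  <<[seq bary_grad i | i <- enum (~: f)%SET]>>%VS.

Lemma bary_grad_normals f i : i \notin f -> bary_grad i \in normals f.
Proof. by move=> fi; apply/memv_span/map_f; rewrite mem_enum inE. Qed.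

(** The difference between [x] and its projection [y] onto the normals is tangent to [f], hence
    orthogonal to both [x] and [y], thus to itself. *)
Lemma tangent_orth f i0 x : i0 \in f ->
  (forall u, u \in tangent v f -> dotv u x = 0) -> x \in normals f.
Proof.
move=> i0f xf; set y := proj (normals f) x.
have yN : y \in normals f by exact: proj_in.
have zN u : u \in normals f -> dotv u (x - y) = 0 by exact: proj_orth.
have zf : x - y \in tangent v f.
  by apply/(mem_tangent _ i0f) => i fi; apply/zN/bary_grad_normals.
suff /eqP : x - y = 0 by rewrite subr_eq0 => /eqP ->.
apply: dotv_eq0; rewrite -[in X in dotv _ X]scaleN1r dotvD dotvZ xf //.
by rewrite dotvC zN // mulr0 addr0.
Qed.

Lemma multilinear_normals f m (b : {ffun 'I_m -> 'rV[R]_d} -> R) :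
  multilinear b ->
  (forall i w j, i \notin f -> b (upd w j (bary_grad i)) = 0) ->
  forall w j n, n \in normals f -> b (upd w j n) = 0.
Proof.
move=> b_lin b0 w j n; rewrite /normals => /coord_span ->.
rewrite multilinear_sum // big1 // => i _.
set n' := nth _ _ _; have /mapP[l] : n' \in [seq bary_grad i | i <- enum (~: f)%SET].
  by rewrite mem_nth // size_tuple.
by rewrite mem_enum inE => fl ->; rewrite b0 ?mulr0.
Qed.

(** The tangent space is spanned by the [#|f| - 1] edges from one vertex [i0], fewer than [m], so
    each term of the expansion repeats an edge or has coefficient 0. For [m] equal to [d - k] this
    explains the lower bound on the dimensions in [bubble_forms]. *)
Lemma altform_in_small f m (b : {ffun 'I_m -> 'rV[R]_d} -> R) w :
  f != finset.set0 -> (#|f| <= m)%N -> altform_in (tangent v f) m b -> b w = 0.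
Proof.
move=> /finset.set0Pn[i0 i0f] fm /altform_inP[b_alt ->].
(* The coefficient at [i0] may be set to 0 because the edge [v i0 - v i0] is zero; this leaves only
   [#|f| - 1] usable indices. *)
pose c j i := if i \in (f :\ i0)%SET
  then dotv (bary_grad i) (proj (tangent v f) (w j)) else 0.
have -> : [ffun j => proj (tangent v f) (w j)] =
    [ffun j => \sum_i c j i *: (v i - v i0)].
  apply/ffunP => j; rewrite !ffunE [LHS](sum_grad_edges _ i0).
  apply: eq_bigr => i _; rewrite /c !inE.
  have [->|_] := eqVneq i i0; first by rewrite subrr !scaler0.
  case: (boolP (i \in f)) => //= fi.
  by rewrite (elimT (mem_tangent _ i0f) (proj_in _ _)) ?scale0r.
rewrite multilinear_expand; last exact: altform_multilinear.
apply: big1 => t _.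
have [/forallP tf|] := boolP [forall j, t j \in (f :\ i0)%SET]; last first.
  rewrite negb_forall => /existsP[j tj].
  by rewrite (bigD1 j) //= /c (negPf tj) !mul0r.
have [/injectiveP t_inj|/injectivePn[i [j ij tij]]] := boolP (injectiveb t); last first.
  by rewrite (b_alt.2 _ i j) ?mulr0 // !ffunE tij.
have : (#|codom t| <= #|(f :\ i0)%SET|)%N.
  by apply/subset_leq_card/fintype.subsetP => _ /codomP[j ->].
by rewrite card_codom // card_ord; have := cardsD1 i0 f; rewrite i0f; lia.
Qed.

(** From left to right, self-adjointness moves the projection onto the tangent space of [f] from [b]
    to the volume form; for [i] outside [f], all rows of the determinant are then orthogonal to the
    gradient at [i]. *)
Lemma hodge_star_tangentP f k m (emk : (m + k)%N = d)
    (a : {ffun 'I_k -> 'rV[R]_d} -> R) :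
  f != finset.set0 -> (0 < d)%N ->
  (hodge_star emk @` altform_in (tangent v f) m) a <->
  altform 'rV[R]_d k a /\
  forall i (w : {ffun 'I_k -> 'rV[R]_d}), i \notin f ->
    (forall j, w j \in tangent v [set~ i]%SET) -> a w = 0.
Proof.
move=> /finset.set0Pn[i0 i0f] d0; split=> [[b /altform_inP[b_alt bP] <-]|[a_alt a0]].
  split=> [|i w fi wi]; first exact: hodge_star_alt.
  have i0i : i0 \in [set~ i]%SET by rewrite !inE; apply: contraNneq fi => <-.
  rewrite hodge_starE; under eq_bigr do rewrite bP.
  rewrite (sum_std_adjoint (altform_multilinear b_alt) (vol_linl emk w)
    (proj_sym _)).
  rewrite big1 ?mulr0 // => t _; rewrite [X in _ * X](_ : _ = 0) ?mulr0 //.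
  apply: (tuple_det_orth (bary_grad_neq0 i d0)) => j.
  case: (cat_ordP emk j) => -[l ->].
    by rewrite cat_tuplel ffunE; exact: (elimT (mem_tangent _ i0f) (proj_in _ _)).
  by rewrite cat_tupler; apply: (elimT (mem_tangent _ i0i) (wi l)); rewrite !inE eqxx.
(* Up to sign, the preimage is the star of a.  Contracting it with n_i amounts to
   fixing a row n_i of the determinant, so that the basis vectors in the other
   rows may be projected onto the hyperplane, where a vanishes. *)
have ekm : (k + m)%N = d by rewrite addnC.
have [e starK] := hodge_starK R emk ekm.
exists (fun w => (-1) ^+ e * hodge_star ekm a w); last first.
  apply/funext => w; rewrite hodge_starZ starK // mulrA -signr_addb addbb mul1r //.
apply/altform_inP; split; first exact/altformZ/hodge_star_alt.
(* Projecting an argument onto the tangent space of [f] subtracts a normal vector, so it suffices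
   that the star vanishes when an argument is a gradient normal to [f]. *)
move=> w; congr (_ * _).
apply: (multilinear_congr (altform_multilinear (hodge_star_alt ekm a))
  (N := fun n => n \in normals f)).
- apply: (multilinear_normals (altform_multilinear (hodge_star_alt ekm a))).
  move=> i u j fi.
  have i0i : i0 \in [set~ i]%SET by rewrite !inE; apply: contraNneq fi => <-.
  rewrite hodge_starE; set u' := upd _ _ _.
  rewrite (eq_bigr (fun t => a (std_tuple R t) *
      vol ekm [ffun l => proj (tangent v [set~ i]%SET) (std_tuple R t l)] u')).
    rewrite -(sum_std_adjoint (altform_multilinear a_alt) (vol_linl ekm u')
      (proj_sym _)) big1 ?mulr0 // => t _.
    by rewrite (a0 i) ?mul0r // => l; rewrite ffunE proj_in.
  move=> t _; congr (_ * _).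
  (* Each basis vector differs from its projection by a multiple of [bary_grad v i], which already
     stands in slot [j] of [u']. *)
  apply: (multilinear_congr (vol_linl ekm u')
    (N := fun n => n \in normals [set~ i]%SET)).
  + apply: (multilinear_normals (vol_linl ekm u')).
    move=> i' z' l'; rewrite !inE negbK => /eqP -> {i'}.
    have [_ da] := tuple_det_alt R d.
    apply: (da _ (cast_ord ekm (lshift m l')) (cast_ord ekm (rshift k j))).
      by rewrite (inj_eq (@cast_ord_inj _ _ ekm)) eq_lrshift.
    by rewrite cat_tuplel cat_tupler !updE !eqxx.
  + by move=> l; rewrite [X in _ - X]ffunE; apply: (tangent_orth i0i); apply: proj_orth.
- by move=> j; rewrite ffunE; apply: (tangent_orth i0f); apply: proj_orth.
Qed.

End Barycentric.

(** * Linear spans and monomials *)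

Section Spans.
Local Open Scope ring_scope.
Variables (R : pzRingType) (V : lmodType R).
Implicit Types S W : set V.

Lemma span_set_ind S W :
  W 0 -> (forall c x y, W x -> W y -> W (c *: x + y)) -> S `<=` W ->
  span_set S `<=` W.
Proof.
move=> W0 Wlin SW _ [n [c [s [sS ->]]]].
by elim/big_rec: _ => // i x _ Wx; apply: Wlin => //; apply/SW/sS.
Qed.

Lemma span_set0 S : span_set S 0.
Proof. by exists 0%N, (fun=> 0), (fun=> 0); split=> [[]|]; rewrite ?big_ord0. Qed.

Lemma span_set_gen S x : S x -> span_set S x.
Proof.
move=> Sx; exists 1%N, (fun=> 1), (fun=> x); split=> //.
by rewrite big_ord1 scale1r.
Qed.

Lemma span_set_lin S c x y :
  span_set S x -> span_set S y -> span_set S (c *: x + y).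
Proof.
move=> [n [a [s [sS ->]]]] [m [b [t [tS ->]]]].
exists (n + m)%N,
  (fun i => match fintype.split i with inl j => c * a j | inr j => b j end),
  (fun i => match fintype.split i with inl j => s j | inr j => t j end).
split=> [i|]; first by case: fintype.split.
rewrite big_split_ord /= scaler_sumr; congr (_ + _); apply: eq_bigr => i _.
  by rewrite (unsplitK (inl _ i)) scalerA.
by rewrite (unsplitK (inr _ i)).
Qed.

Lemma span_setD S x y : span_set S x -> span_set S y -> span_set S (x + y).
Proof. by move=> Sx Sy; rewrite -[x]scale1r; apply: span_set_lin. Qed.

Lemma span_setZ S c x : span_set S x -> span_set S (c *: x).
Proof. by move=> Sx; rewrite -[_ *: _]addr0; apply: span_set_lin (span_set0 S). Qed.

Lemma span_set_sum S (I : Type) (l : seq I) (P : pred I) (F : I -> V) :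
  (forall i, P i -> span_set S (F i)) -> span_set S (\sum_(i <- l | P i) F i).
Proof.
by move=> SF; elim/big_ind: _ => //; [apply: span_set0|apply: span_setD].
Qed.

End Spans.

Section Monomials.
Local Open Scope ring_scope.

Lemma digits_inj n B (a b : 'I_n -> nat) :
  (forall i, a i < B)%N -> (forall i, b i < B)%N ->
  (\sum_(i < n) a i * B ^ i = \sum_(i < n) b i * B ^ i)%N -> a =1 b.
Proof.
elim: n a b => [a b _ _ _ []//|n IH] a b aB bB.
have shift (e : 'I_n.+1 -> nat) : (\sum_(i < n.+1) e i * B ^ i =
    (\sum_(i < n) e (lift ord0 i) * B ^ i) * B + e ord0)%N.
  rewrite big_ord_recl expn0 muln1 addnC big_distrl; congr (_ + _)%N.
  by apply: eq_bigr => i _; rewrite /= expnSr mulnA.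
have B0 : (0 < B)%N by apply: leq_ltn_trans (aB ord0).
rewrite !shift => E.
have E0 : a ord0 = b ord0.
  by have := congr1 (modn^~ B) E; rewrite !modnMDl !modn_small.
have El : (fun i => a (lift ord0 i)) =1 (fun i => b (lift ord0 i)).
  by apply: IH => //; have := congr1 (divn^~ B) E; rewrite !divnMDl ?divn_small ?addn0.
by move=> i; case: (unliftP ord0 i) => [j|] ->; [apply: El|].
Qed.

(* Kronecker substitution: at y_i = t^(B^i) distinct exponent vectors with
   entries below B give distinct powers of t. *)
Lemma monomials_free (R : realType) n B (c : {ffun 'I_n -> 'I_B} -> R) :
  (forall y : 'I_n -> R, (forall i, 0 < y i) ->
     \sum_(a : {ffun 'I_n -> 'I_B}) c a * \prod_i y i ^+ a i = 0) ->
  forall a, c a = 0.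
Proof.
move=> c0 a0; pose N (a : {ffun 'I_n -> 'I_B}) := (\sum_i a i * B ^ i)%N.
have N_inj : injective N.
  move=> a b /digits_inj ab; apply/ffunP => i; apply: val_inj.
  by apply: (ab _ _ i) => j; apply: ltn_ord.
pose P := \sum_a c a *: 'X^(N a).
have Pt t : 0 < t -> P.[t] = 0.
  move=> t0; rewrite horner_sum -[RHS](c0 (fun i => t ^+ (B ^ i))); last first.
    by move=> i; apply: exprn_gt0.
  apply: eq_bigr => a _; rewrite hornerZ hornerXn; congr (_ * _).
  rewrite expr_sum; apply: eq_bigr => i _.
  by rewrite -exprM mulnC.
have P0 : P = 0.
  apply/eqP/negPn/negP => Pn0.
  (* The integers from 1 to [size P] would be [size P] distinct roots, more than the degree
     allows. *)
  have := @max_poly_roots R P [seq i.+1%:R | i <- iota 0 (size P)] Pn0.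
  rewrite size_map size_iota ltnn => H; suff : false by []; apply: H.
    by apply/allP => _ /mapP[i _ ->]; apply/eqP/Pt; rewrite ltr0Sn.
  by rewrite map_inj_uniq ?iota_uniq // => i j /eqP; rewrite eqr_nat => /eqP[].
have := congr1 (fun p : {poly R} => p`_(N a0)) P0.
rewrite coef0 coef_sum (bigD1 a0) //= big1 => [|a aa0].
  by rewrite coefZ coefXn eqxx mulr1 addr0.
by rewrite coefZ coefXn (inj_eq N_inj) eq_sym (negPf aa0) mulr0.
Qed.

End Monomials.

(** * The Bernstein basis *)

Section Bernstein.
Local Open Scope ring_scope.
Variables (R : realType) (d : nat) (v : 'I_d.+1 -> 'rV[R]_d).
Hypothesis v_indep : affinely_independent v.
Implicit Types (p q : {mpoly R[d]}).

(** The identity (1, X) = lambda * [bary_mx] between polynomials, read in column [j]: the first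
    column yields the partition of unity, the others recover the coordinates. *)
Lemma sum_bary_mx (j : 'I_(1 + d)) :
  \sum_i bary_mx v i j *: bary v i =
  ((lshift d 0 == j)%:R)%:MP + \sum_l ((rshift 1 l == j)%:R : R) *: 'X_l.
Proof.
have invE i : (i == j)%:R = \sum_l bary_mx v l j * invmx (bary_mx v) i l.
  have := congr1 (fun M : 'M_(1 + d) => M i j) (mulVmx (bary_mx_unit v_indep)).
  rewrite !mxE => <-; apply: eq_bigr => l _; exact: mulrC.
under eq_bigr do rewrite scalerDr; rewrite big_split /=; congr (_ + _).
  rewrite invE raddf_sum; apply: eq_bigr => i _.
  by rewrite /= -mul_mpolyC -mpolyCM.
under eq_bigr do rewrite scaler_sumr; rewrite exchange_big /=.
apply: eq_bigr => l _; rewrite invE scaler_suml; apply: eq_bigr => i _.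
by rewrite scalerA.
Qed.

Lemma sum_baryE : \sum_i bary v i = 1.
Proof.
have := sum_bary_mx (lshift d 0); rewrite eqxx [X in _ + X]big1 => [|l _]; last first.
  by rewrite eq_rlshift scale0r.
by rewrite addr0 mulr1n mpolyC1 => <-; apply: eq_bigr => i _; rewrite bary_mxl scale1r.
Qed.

Lemma sum_bary_coord j : \sum_i v i 0 j *: bary v i = 'X_j.
Proof.
have := sum_bary_mx (rshift 1 j); rewrite eq_lrshift [X in _ + X](bigD1 j) //= eqxx.
rewrite [X in _ + (_ + X)]big1.
  rewrite mulr0n mpolyC0 add0r addr0 mulr1n scale1r => <-.
  by apply: eq_bigr => i _; rewrite bary_mxr.
by move=> l lj; rewrite eq_rshift (negPf lj) scale0r.
Qed.

Definition bary_monomials (n : nat) : set {mpoly R[d]} :=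
  [set p | exists a : 'I_d.+1 -> nat,
     (\sum_i a i)%N = n /\ p = \prod_i bary v i ^+ a i].

Lemma bary_monomialsM n m p q :
  span_set (bary_monomials n) p -> span_set (bary_monomials m) q ->
  span_set (bary_monomials (n + m)) (p * q).
Proof.
move=> np; move: q; apply: span_set_ind => [|c x y xS yS|_ [b [bm ->]]].
- by rewrite mulr0; apply: span_set0.
- by rewrite mulrDr -scalerAr; apply: span_set_lin.
move: p np; apply: span_set_ind => [|c x y xS yS|_ [a [an ->]]].
- by rewrite mul0r; apply: span_set0.
- by rewrite mulrDl -scalerAl; apply: span_set_lin.
apply: span_set_gen; exists (fun i => a i + b i)%N.
rewrite big_split /= an bm; split=> //; rewrite -big_split /=.
by apply: eq_bigr => i _; rewrite exprD.
Qed.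

Lemma bary_monomials1 : span_set (bary_monomials 0) 1.
Proof.
apply: span_set_gen; exists (fun=> 0%N); rewrite big1_eq big1 //.
Qed.

Lemma bary_monomialsX n m p :
  span_set (bary_monomials n) p -> span_set (bary_monomials (n * m)) (p ^+ m).
Proof.
move=> np; elim: m => [|m IH]; first by rewrite muln0; apply: bary_monomials1.
by rewrite mulnS exprS; apply: bary_monomialsM.
Qed.

Lemma bary_monomials_linear (c : 'I_d.+1 -> R) :
  span_set (bary_monomials 1) (\sum_i c i *: bary v i).
Proof.
apply: span_set_sum => i _; apply/span_setZ/span_set_gen.
exists (fun j => j == i : nat); split.
  by rewrite (bigD1 i) //= eqxx big1 // => j /negPf ->.
by rewrite (bigD1 i) //= eqxx big1 ?mulr1 // => j /negPf ->.
Qed.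

(** Each coordinate is a linear form in the barycentric coordinates, and a monomial of lower degree
    is made homogeneous by a power of their sum, which is 1. *)
Lemma poly_le_bary_monomials n p :
  poly_le n p -> span_set (bary_monomials n) p.
Proof.
move=> pn; rewrite (mpolyE p) big_seq; apply: span_set_sum => m mp.
apply: span_setZ; have mn : (mdeg m <= n)%N.
  by rewrite -ltnS (leq_trans (msize_mdeg_lt mp)).
rewrite -(subnKC mn) -['X_[m]]mulr1; apply: bary_monomialsM.
  rewrite mpolyXE_id mdegE.
  elim/big_rec2: _ => [|i x y _ xy]; first exact: bary_monomials1.
  apply: bary_monomialsM => //.
  have := bary_monomialsX (m i) (bary_monomials_linear (fun l => v l 0 i)).
  by rewrite mul1n sum_bary_coord.
have := bary_monomialsX (n - mdeg m) (bary_monomials_linear (fun=> 1)).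
under eq_bigr do rewrite scale1r.
by rewrite mul1n sum_baryE expr1n.
Qed.

Lemma poly_leM n m p q : poly_le n p -> poly_le m q -> poly_le (n + m) (p * q).
Proof.
rewrite /poly_le /= => pn qm.
have [->|p0] := eqVneq p 0; first by rewrite mul0r msize0.
have [->|q0] := eqVneq q 0; first by rewrite mulr0 msize0.
by rewrite msizeM // -subn1 leq_subLR add1n (leq_trans (leq_add pn qm)) // addSn addnS.
Qed.

Lemma poly_leD n p q : poly_le n p -> poly_le n q -> poly_le n (p + q).
Proof.
by rewrite /poly_le /= => pn qm; rewrite (leq_trans (msizeD_le _ _)) // geq_max pn.
Qed.

Lemma poly_leZ n (c : R) p : poly_le n p -> poly_le n (c *: p).
Proof. by rewrite /poly_le /=; apply/leq_trans/msizeZ_le. Qed.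

Lemma poly_le_bary i : poly_le 1 (bary v i).
Proof.
apply: poly_leD; first by rewrite /poly_le /= msizeC (leq_trans (leq_b1 _)).
elim/big_ind: _ => [|p q|j _]; [by rewrite /poly_le /= msize0|exact: poly_leD|].
by apply: poly_leZ; rewrite /poly_le /= msizeX mdeg1.
Qed.

Lemma poly_le_prod (a : 'I_d.+1 -> nat) :
  poly_le (\sum_i a i)%N (\prod_i bary v i ^+ a i).
Proof.
have le1 : poly_le 0 (1 : {mpoly R[d]}) by rewrite /poly_le /= msize1.
elim/big_rec2: _ => // i x y _ xy; apply: poly_leM => //.
elim: (a i) => // n IH; rewrite exprS -add1n.
by apply: poly_leM => //; apply: poly_le_bary.
Qed.

End Bernstein.

(** * The Bernstein monomials of degree [r], sorted by support *)

Section BernsteinBasis.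
Local Open Scope ring_scope.
Variables (R : realType) (d : nat) (v : 'I_d.+1 -> 'rV[R]_d).
Hypothesis v_indep : affinely_independent v.
Variable r : nat.
(** Bounding the exponents by [r] gives a finite type to sum over; no exponent vector of total
    degree [r] is lost. *)
Notation expo := {ffun 'I_d.+1 -> 'I_r.+1}.
Implicit Types (a : expo) (p : {mpoly R[d]}) (c : expo -> R) (f : {set 'I_d.+1}).

Definition bernstein a : {mpoly R[d]} := \prod_i bary v i ^+ a i.
Definition deg a : nat := (\sum_i a i)%N.
Definition supp a : {set 'I_d.+1} := [set i | (a i : nat) != 0%N]%SET.

Lemma notin_supp a i : i \notin supp a -> a i = 0%N :> nat.
Proof. by rewrite inE negbK => /eqP. Qed.

Lemma meval_bernstein a (w : 'I_d.+1 -> R) : \sum_i w i = 1 ->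
  (bernstein a).@[(\sum_i w i *: v i) 0] = \prod_i w i ^+ a i.
Proof.
move=> w1; rewrite rmorph_prod; apply: eq_bigr => i _.
by rewrite rmorphXn /= meval_bary_comb.
Qed.

Lemma face_comb f x : face v f x -> exists w : 'I_d.+1 -> R,
  [/\ forall i, i \notin f -> w i = 0, \sum_i w i = 1 & x = \sum_i w i *: v i].
Proof.
move=> [w [_ w1 ->]]; exists (fun i => if i \in f then w i else 0); split.
- by move=> i /negPf ->.
- by rewrite -w1 [RHS]big_mkcond.
- by rewrite [LHS]big_mkcond; apply: eq_bigr => i _; case: ifP; rewrite ?scale0r.
Qed.

Lemma meval_bernstein_face f x a :
  face v f x -> ~~ (supp a \subset f) -> (bernstein a).@[x 0] = 0.
Proof.
move=> /face_comb[w [w0 w1 ->]] /subsetPn[i ai fi].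
rewrite meval_bernstein // (bigD1 i) //= w0 // expr0n.
by move: ai; rewrite inE => /negPf ->; rewrite mul0r.
Qed.

(** For positive [y], the weights on [f] proportional to [y] give a point of the face, and the
    factor [s ^+ r] clears the normalization by homogeneity. The vanishing becomes an identity in
    all positive [y], to which [monomials_free] applies. *)
Lemma bernstein_face_free f c : f != finset.set0 ->
  (forall x, face v f x -> (\sum_(a | deg a == r) c a *: bernstein a).@[x 0] = 0) ->
  forall a, deg a = r -> supp a \subset f -> c a = 0.
Proof.
move=> /finset.set0Pn[i0 i0f] cf a ar af.
(* Coefficient 0 goes to the monomials of another degree and to those whose support leaves [f],
   which vanish on the face. *)
pose c' a := if (deg a == r) && (supp a \subset f) then c a else 0.
suff : c' a = 0 by rewrite /c' ar eqxx af.
apply: monomials_free => y y0; pose s := \sum_(i in f) y i.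
have s0 : 0 < s.
  by rewrite /s (bigD1 i0) //= ltr_pwDl // sumr_ge0 // => i _; apply: ltW.
pose w i := if i \in f then y i / s else 0.
have w1 : \sum_i w i = 1.
  by rewrite -big_mkcond /= -mulr_suml divff // gt_eqF.
have fx : face v f (\sum_i w i *: v i).
  exists w; split=> [i||].
  - by rewrite /w; case: ifP => // _; rewrite divr_ge0 // ltW.
  - by rewrite -w1 [LHS]big_mkcond; apply: eq_bigr => i _; rewrite /w; case: (i \in f).
  - rewrite [RHS]big_mkcond; apply: eq_bigr => i _; rewrite /w.
    by case: (i \in f); rewrite ?scale0r.
have := cf _ fx; rewrite raddf_sum /= => E.
transitivity (s ^+ r * \sum_(a | deg a == r)
    (c a *: bernstein a).@[(\sum_i w i *: v i) 0]); last by rewrite E mulr0.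
rewrite mulr_sumr [RHS]big_mkcond /=.
apply: eq_bigr => {ar af}a _; rewrite /c'.
case: eqP => [ar|_] /=; last by rewrite mul0r.
rewrite mevalZ; have [af|af] := boolP (supp a \subset f); last first.
  by rewrite (meval_bernstein_face fx af) mul0r !mulr0.
rewrite mulrCA; congr (_ * _); rewrite meval_bernstein // -[X in s ^+ X]ar /deg expr_sum.
rewrite -big_split /=; apply: eq_bigr => i _; rewrite -exprMn /w.
case: ifP => fi; first by rewrite mulrC divfK // gt_eqF.
by rewrite notin_supp ?expr0 //; apply: contraFN fi => /(fintype.subsetP af).
Qed.

Lemma bernstein_free c :
  \sum_(a | deg a == r) c a *: bernstein a = 0 -> forall a, deg a = r -> c a = 0.
Proof.
move=> c0 a ar; apply: (bernstein_face_free (f := [set: 'I_d.+1]%SET)) => //.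
- by apply/finset.set0Pn; exists ord0; rewrite inE.
- by move=> x _; rewrite c0 meval0.
Qed.

Lemma bernstein_span p :
  poly_le r p -> exists c, p = \sum_(a | deg a == r) c a *: bernstein a.
Proof.
move/(poly_le_bary_monomials v_indep); move: p; apply: span_set_ind.
- by exists (fun=> 0); rewrite big1 // => a _; rewrite scale0r.
- move=> e _ _ [c ->] [c' ->]; exists (fun a => e * c a + c' a).
  rewrite scaler_sumr -big_split /=; apply: eq_bigr => a _.
  by rewrite scalerDl scalerA.
- move=> _ [e [er ->]]; pose a : expo := [ffun i => inord (e i)].
  have ae i : a i = e i :> nat.
    by rewrite ffunE inordK // ltnS -er (bigD1 i) //= leq_addr.
  exists (fun b => (b == a)%:R); rewrite (bigD1 a) /=; last first.
    by rewrite -[X in _ == X]er; apply/eqP/eq_bigr.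
  rewrite eqxx scale1r [X in _ + X]big1; last first.
    by move=> b /andP[_ /negPf ->]; rewrite scale0r.
  by rewrite addr0; apply: eq_bigr => i _; rewrite ae.
Qed.

Lemma poly_forms_bernstein k (u : pform R d k) : poly_forms R d r k u ->
  exists b : expo -> {ffun 'I_k -> 'rV[R]_d} -> R,
    (forall a, altform 'rV[R]_d k (b a)) /\
    u = fun w => \sum_(a | deg a == r) b a w *: bernstein a.
Proof.
move: u; apply: span_set_ind.
- exists (fun _ _ => 0); split=> [a|]; first exact: altform0.
  by apply/funext => w; rewrite big1 // => a _; rewrite scale0r.
- move=> e _ _ [b [b_alt ->]] [b' [b'_alt ->]].
  exists (fun a w => e * b a w + b' a w); split=> [a|].
    exact: altform_lin.
  apply/funext => w; rewrite /= [LHS](_ : _ =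
    e *: (\sum_(a | deg a == r) b a w *: bernstein a) +
    \sum_(a | deg a == r) b' a w *: bernstein a) //.
  rewrite scaler_sumr -big_split /=; apply: eq_bigr => a _.
  by rewrite scalerDl scalerA.
- move=> _ [p pr [b b_alt <-]]; have [c ->] := bernstein_span pr.
  exists (fun a w => c a * b w); split=> [a|]; first exact: altformZ.
  apply/funext => w; rewrite scaler_sumr; apply: eq_bigr => a _.
  by rewrite scalerA mulrC.
Qed.

Definition bernstein_space (Q : pred expo) : set {mpoly R[d]} :=
  [set p | exists c, p = \sum_(a | (deg a == r) && Q a) c a *: bernstein a].

Lemma bernstein_space0 Q : bernstein_space Q 0.
Proof. by exists (fun=> 0); rewrite big1 // => a _; rewrite scale0r. Qed.

Lemma bernstein_space_lin Q e p q :
  bernstein_space Q p -> bernstein_space Q q -> bernstein_space Q (e *: p + q).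
Proof.
move=> [c ->] [c' ->]; exists (fun a => e * c a + c' a).
rewrite scaler_sumr -big_split /=; apply: eq_bigr => a _.
by rewrite scalerDl scalerA.
Qed.

Lemma bernstein_spaceS (Q Q' : pred expo) p :
  (forall a, Q a -> Q' a) -> bernstein_space Q p -> bernstein_space Q' p.
Proof.
move=> QQ' [c ->]; exists (fun a => if Q a then c a else 0).
rewrite big_mkcond [RHS]big_mkcond; apply: eq_bigr => a _.
case: eqP => //= _; case: ifP => [/QQ' -> //|_].
by rewrite scale0r if_same.
Qed.

Lemma bernstein_space_sum Q (I : finType) (P : pred I) (F : I -> {mpoly R[d]}) :
  (forall i, P i -> bernstein_space Q (F i)) ->
  bernstein_space Q (\sum_(i | P i) F i).
Proof.
move=> QF; elim/big_ind: _ => //; first exact: bernstein_space0.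
by move=> x y xQ yQ; rewrite -[x]scale1r; apply: bernstein_space_lin.
Qed.

Lemma bernstein_space_le Q p : bernstein_space Q p -> poly_le r p.
Proof.
move=> [c ->]; elim/big_ind: _ => [|x y|a /andP[/eqP ar _]].
- by rewrite /poly_le /= msize0.
- exact: poly_leD.
- by apply: poly_leZ; rewrite -[X in poly_le X]ar; apply: poly_le_prod.
Qed.

(** The map [g] sorts the basis into classes. The [p k] use disjoint classes, so their coefficients
    merge into a single family, which vanishes by [bernstein_free]. *)
Lemma bernstein_space_direct (K : finType) (P : pred K) (g : expo -> K)
    (p : K -> {mpoly R[d]}) :
  (forall k, P k -> bernstein_space (fun a => g a == k) (p k)) ->
  \sum_(k | P k) p k = 0 -> forall k, P k -> p k = 0.
Proof.
move=> pP p0.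
have /choice[c cE] : forall k, exists c, P k ->
    p k = \sum_(a | (deg a == r) && (g a == k)) c a *: bernstein a.
  move=> k; have [Pk|_] := boolP (P k); last by exists (fun=> 0).
  by have [c pE] := pP k Pk; exists c.
move=> k Pk; rewrite cE // big1 // => a /andP[/eqP ar /eqP gk].
suff : (if P (g a) then c (g a) a else 0) = 0.
  by rewrite gk Pk => ->; rewrite scale0r.
apply: (bernstein_free (c := fun a => if P (g a) then c (g a) a else 0)) => //.
rewrite -[RHS]p0 (eq_bigr (fun a => if P (g a) then c (g a) a *: bernstein a else 0)).
  rewrite -big_mkcondr (partition_big g P) /=; last by move=> ? /andP[].
  apply: eq_bigr => k' Pk'; rewrite cE //; apply: eq_big => [b|b].
    by case: (eqVneq (g b) k') => [->|]; rewrite ?Pk' ?andbT ?andbF.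
  by move=> /andP[_ /eqP ->].
by move=> b _; case: ifP => // _; rewrite scale0r.
Qed.

Lemma card_subsimplices (l : nat) f : f \in subsimplices d l -> #|f| = l.+1.
Proof. by rewrite inE => /eqP. Qed.

(** The bubble raises each exponent on [f] by one: the degree grows from [r - (l + 1)] to [r], and
    the support becomes exactly [f]. *)
Lemma face_poly_bubble (l : nat) f p : f \in subsimplices d l ->
  face_poly v f (r%:Z - l.+1%:Z) p ->
  bernstein_space (fun a => supp a == f) (p * bubble v f).
Proof.
move=> /card_subsimplices fl; move: p; apply: span_set_ind.
- by rewrite mul0r; apply: bernstein_space0.
- by move=> c x y xS yS; rewrite mulrDl -scalerAl; apply: bernstein_space_lin.
move=> _ [e [er ->]]; pose h i : nat := if i \in f then (e i).+1 else 0%N.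
have hr : (\sum_i h i = r)%N.
  rewrite -big_mkcond /=; under eq_bigr do rewrite -addn1.
  rewrite big_split /= sum1_card fl.
  by move: er; move: (\sum_(i in f) e i)%N => s; clear v_indep; lia.
pose a : expo := [ffun i => inord (h i)].
have ah i : a i = h i :> nat.
  by rewrite ffunE inordK // ltnS -hr (bigD1 i) //= leq_addr.
exists (fun b => (b == a)%:R); rewrite (bigD1 a) /=; last first.
  apply/andP; split; first by rewrite -[X in _ == X]hr; apply/eqP/eq_bigr.
  by apply/eqP/setP => i; rewrite inE ah /h; case: ifP.
rewrite eqxx scale1r [X in _ + X]big1; last first.
  by move=> b /andP[_ /negPf ->]; rewrite scale0r.
rewrite addr0 /bubble -big_split /bernstein [LHS]big_mkcond; apply: eq_bigr => i _.
by rewrite ah /h; case: ifP => _ //=; rewrite exprSr.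
Qed.

(** Converse to [face_poly_bubble] on basis elements: the exponents on the support are positive, so
    one can be taken off each. *)
Lemma bernstein_bubble (l : nat) f a :
  f \in subsimplices d l -> deg a = r -> supp a = f ->
  [set q * bubble v f | q in face_poly v f (r%:Z - l.+1%:Z)] (bernstein a).
Proof.
move=> /card_subsimplices fl ar af.
have aE i : (a i : nat) = if i \in f then (a i).-1.+1 else 0%N.
  by rewrite -af inE; case: (a i : nat).
exists (\prod_(i in f) bary v i ^+ (a i).-1).
  apply: span_set_gen; exists (fun i => (a i).-1); split=> //.
  have : (\sum_(i in f) (a i).-1 + l.+1 = r)%N.
    rewrite -fl -sum1_card -big_split /= -[RHS]ar /deg big_mkcond.
    by apply: eq_bigr => i _; rewrite [RHS]aE; case: ifP; rewrite ?addn1.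
  by move: (\sum_(i in f) (a i).-1)%N => s; clear v_indep; lia.
rewrite /bubble -big_split big_mkcond; apply: eq_bigr => i _ /=.
by rewrite [in RHS]aE; case: ifP => // _; rewrite -exprSr.
Qed.

End BernsteinBasis.

(** * Bubble forms *)

Section Bubbles.
Local Open Scope ring_scope.
Variables (R : realType) (d : nat) (v : 'I_d.+1 -> 'rV[R]_d).
Hypothesis v_indep : affinely_independent v.
Variables (r k : nat) (hk : (k <= d)%N).
Implicit Types (f : {set 'I_d.+1}) (u : pform R d k).
Notation expo := {ffun 'I_d.+1 -> 'I_r.+1}.

(** A subsimplex with n vertices has dimension n - 1. The empty support also gets 0; for [r]
    positive it does not occur in degree [r]. *)
Definition supp_dim (a : expo) : 'I_d.+1 := inord #|supp a|.-1.

Lemma supp_dim_subsimplices (l : 'I_d.+1) f a :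
  f \in subsimplices d l -> supp a = f -> supp_dim a = l.
Proof.
by move=> /card_subsimplices fl sa; apply: val_inj; rewrite /= inordK sa fl //= ltn_ord.
Qed.

Lemma bubble_summand_space (l : nat) f u w :
  f \in subsimplices d l -> bubble_summand v r hk l f u ->
  bernstein_space v (fun a : expo => supp a == f) (u w).
Proof.
move=> fl; suff uS : bubble_summand v r hk l f `<=` [set u : pform R d k |
    bernstein_space v (fun a : expo => supp a == f) (u w)] by move/uS.
apply: span_set_ind => /=.
- exact: bernstein_space0.
- by move=> c x y; apply: bernstein_space_lin.
- move=> _ [_ [q qf <-] [b _ <-]] /=; rewrite -[X in bernstein_space _ _ X]addr0.
  apply: bernstein_space_lin; last exact: bernstein_space0.
  exact: face_poly_bubble fl qf.
Qed.

Lemma bubble_level_space (l : 'I_d.+1) u w :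
  bubble_level v r hk l u -> bernstein_space v (fun a : expo => supp_dim a == l) (u w).
Proof.
move=> [U [US ->]]; rewrite fct_sumE; apply: bernstein_space_sum => f fl.
apply: bernstein_spaceS (bubble_summand_space w fl (US f fl)) => a /eqP sa.
by apply/eqP/(supp_dim_subsimplices fl).
Qed.

(** At a fixed tuple [w], distinct summands use Bernstein monomials with distinct supports;
    [supp_dim] separates the levels, [supp] the subsimplices of one level. *)
Lemma bubble_forms_directP : bubble_forms_direct v r hk.
Proof.
split=> [u uS u0 l dl|l dl u uS u0 f fl]; apply/funext => w.
  apply: (bernstein_space_direct v_indep (g := supp_dim)
    (P := fun l : 'I_d.+1 => (d - k <= l)%N) (p := fun l => u l w)) => //.
    by move=> l' dl'; apply/bubble_level_space/uS.
  by have := congr1 (fun g => g w) u0; rewrite fct_sumE.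
apply: (bernstein_space_direct v_indep (g := @supp d r)
  (P := fun f => f \in subsimplices d l) (p := fun f => u f w)) => //.
  by move=> f' fl'; apply: bubble_summand_space (uS f' fl').
by have := congr1 (fun g => g w) u0; rewrite fct_sumE.
Qed.

Lemma bubble_summand_poly_forms (l : nat) f :
  f \in subsimplices d l -> bubble_summand v r hk l f `<=` poly_forms R d r k.
Proof.
move=> fl; apply: span_set_ind; first exact: span_set0.
  by move=> c x y; apply: span_set_lin.
move=> _ [_ [q qf <-] [b [a _ <-] <-]]; apply: span_set_gen.
exists (q * bubble v f); first exact: bernstein_space_le (face_poly_bubble fl qf).
by exists (hodge_star (subnK hk) a) => //; apply: hodge_star_alt.
Qed.

Lemma facetP (F : {set 'I_d.+1}) : (0 < d)%N ->
  F \in subsimplices d d.-1 -> exists i, F = [set~ i]%SET.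
Proof.
move=> d0 /card_subsimplices Fd.
have /eqP/cards1P[i Fi] : #|(~: F)%SET| = 1%N.
  by have := cardsC F; rewrite Fd card_ord; clear -d0; lia.
by exists i; rewrite -Fi finset.setCK.
Qed.

Lemma facet_subsimplices i : (0 < d)%N -> [set~ i]%SET \in subsimplices d d.-1.
Proof. by move=> d0; rewrite inE cardsC1 card_ord prednK. Qed.

Lemma face_trace_lin F c (x y : pform R d k) p t :
  face_trace (v := v) (f := F) (c *: x + y) p t =
  c * face_trace x p t + face_trace y p t.
Proof. by rewrite /face_trace -mevalZ -mevalD. Qed.

(** Let the facet be opposite to vertex [i]. If [i] is in [f], the polynomial factor vanishes on the
    facet; otherwise the form factor vanishes on its tangent space. *)
Lemma bubble_summand_trace (l : nat) f : (0 < d)%N ->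
  f \in subsimplices d l -> bubble_summand v r hk l f `<=` ker_boundary_trace v k.
Proof.
move=> d0 fl; apply: span_set_ind.
- by move=> F _ x t; apply: meval0.
- by move=> c x y xk yk F Fd p t; rewrite face_trace_lin xk // yk // mulr0 addr0.
move=> _ [_ [q qf <-] [b bf <-]] F /(facetP d0)[i ->] x t.
rewrite /face_trace mevalZ.
have f0 : f != finset.set0.
  by apply/eqP => f0; have := card_subsimplices fl; rewrite f0 cards0.
have [_ b0] := (hodge_star_tangentP v_indep (subnK hk) b f0 d0).1 bf.
have [fi|fi] := boolP (i \in f); last first.
  by rewrite (b0 i) ?mul0r // => j; rewrite ffunE; apply: subvsP.
have [c ->] := face_poly_bubble fl qf.
rewrite raddf_sum /= big1 ?mulr0 // => a /andP[_ /eqP sa].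
rewrite mevalZ (meval_bernstein_face v_indep (svalP x)) ?mulr0 //.
by apply/subsetPn; exists i; rewrite ?sa // !inE eqxx.
Qed.

Lemma bubble_forms_sub : (0 < d)%N ->
  bubble_forms v r hk `<=` poly_forms R d r k `&` ker_boundary_trace v k.
Proof.
move=> d0 _ [u [uS ->]]; split.
  apply: span_set_sum => l dl; have [U [US ->]] := uS l dl.
  by apply: span_set_sum => f fl; apply: (bubble_summand_poly_forms fl); apply: US.
have kerD (I : finType) (P : pred I) (U : I -> pform R d k) :
    (forall i, P i -> ker_boundary_trace v k (U i)) ->
    ker_boundary_trace v k (\sum_(i | P i) U i).
  move=> Uk; elim/big_ind: _ => [F _ x t|x y xk yk F Fd p t|i Pi].
  - exact: meval0.
  - by rewrite -[x]scale1r face_trace_lin xk // yk // mulr0 addr0.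
  - exact: Uk.
apply: (kerD _ (fun l : 'I_d.+1 => (d - k <= l)%N) u) => l dl.
have [U [US ->]] := uS l dl.
apply: (kerD _ (fun f => f \in subsimplices d l) U) => f fl.
by apply: (bubble_summand_trace d0 fl); apply: US.
Qed.

Lemma bubble_forms_sup : (0 < d)%N -> (0 < r)%N ->
  poly_forms R d r k `&` ker_boundary_trace v k `<=` bubble_forms v r hk.
Proof.
move=> d0 r0 _ [/(poly_forms_bernstein v_indep)[b [b_alt ->]] ker_b].
have supp0 a : deg a = r -> @supp d r a != finset.set0.
  move=> ar; apply: contraTneq r0 => s0; rewrite -[r]ar /deg big1 // => i _.
  by apply: notin_supp; rewrite s0 inE.
(* On a facet containing the support of [a], the surviving monomials are free, so the zero trace
   kills [b a] on its tangent space; [hodge_star_tangentP] turns this into a star. *)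
have b_star a : deg a = r ->
    (hodge_star (subnK hk) @` altform_in (tangent v (supp a)) (d - k)%N) (b a).
  move=> ar; apply/(hodge_star_tangentP v_indep (subnK hk) _ (supp0 a ar) d0).
  split=> // i w si wi.
  have sai : supp a \subset [set~ i]%SET.
    apply/fintype.subsetP => j; rewrite !inE; apply: contraTneq => ->.
    by rewrite inE in si.
  have i0 : [set~ i]%SET != finset.set0.
    have /finset.set0Pn[j ja] := supp0 a ar; apply/finset.set0Pn; exists j.
    exact: (fintype.subsetP sai).
  apply: (bernstein_face_free v_indep (c := fun a => b a w) i0 _ ar sai) => x xi.
  (* The trace takes its arguments in the subtype of tangent vectors; [vsproj] puts [w] there and
     loses nothing, since the entries of [w] are tangent. *)
  have := ker_b _ (facet_subsimplices i d0) (exist _ x xi)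
    [ffun j => vsproj (tangent v [set~ i]%SET) (w j)].
  rewrite /face_trace /= [X in \sum_(_ | _) b _ X *: _](_ : _ = w) //.
  by apply/ffunP => j; rewrite !ffunE vsprojK.
have b_small a w : deg a = r -> (#|supp a| <= d - k)%N -> b a w = 0.
  move=> ar sa; have [b' b'in <-] := b_star a ar.
  rewrite hodge_starE big1 ?mulr0 // => t _.
  by rewrite (altform_in_small v_indep _ (supp0 a ar) sa b'in) mul0r.
pose U f : pform R d k :=
  fun w => \sum_(a | (deg a == r) && (supp a == f)) b a w *: bernstein v a.
exists (fun l : 'I_d.+1 => \sum_(f in subsimplices d l) U f); split=> [l dl|].
  exists U; split=> // f fl.
  have -> : U f = \sum_(a | (deg a == r) && (supp a == f))
      ((fun w => b a w *: bernstein v a) : pform R d k).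
    by apply/funext => w; rewrite fct_sumE.
  apply: span_set_sum => a /andP[/eqP ar /eqP sa]; apply: span_set_gen.
  exists (bernstein v a); first exact: bernstein_bubble.
  by exists (b a) => //; rewrite -sa; apply: b_star.
apply/funext => w; rewrite fct_sumE.
(* The supports of dimension below [d - k] drop out; the rest is grouped by dimension, then by
   support, as in the nested sums of [bubble_forms]. *)
rewrite (bigID (fun a => d - k < #|supp a|)%N) /= [X in _ + X]big1 ?addr0; last first.
  by move=> a /andP[/eqP ar]; rewrite -leqNgt => /b_small -> //; rewrite scale0r.
have card_supp a : (#|@supp d r a| <= d.+1)%N.
  by rewrite -[X in (_ <= X)%N](card_ord d.+1) max_card.
rewrite (partition_big supp_dim (fun l : 'I_d.+1 => (d - k <= l)%N)) /=; last first.
  move=> a /andP[_]; move: (card_supp a); rewrite /supp_dim.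
  by move: #|supp a| => n nd kn; rewrite inordK; lia.
apply: eq_bigr => l dl; rewrite fct_sumE.
rewrite (partition_big (@supp d r) (fun f => f \in subsimplices d l)) /=; last first.
  move=> a /andP[/andP[_ sa] /eqP <-]; rewrite inE /supp_dim; move: (card_supp a) sa.
  by move: #|supp a| => n nd kn; rewrite inordK; lia.
apply: eq_bigr => f fl; apply: eq_bigl => a.
have [sa|] := eqVneq (supp a) f; last by rewrite !andbF.
by rewrite (supp_dim_subsimplices fl sa) eqxx sa (card_subsimplices fl) ltnS dl !andbT.
Qed.

End Bubbles.

Theorem corollary5p8 (R : realType) (d k r : nat)
    (hd : (2 <= d)%N) (hk : (k <= d.-1)%N) (hr : (1 <= r)%N)
    (v : 'I_d.+1 -> 'rV[R]_d) (hT : affinely_independent v) :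
  let hkd : (k <= d)%N := leq_trans hk (leq_pred d) in
  bubble_forms_direct v r hkd /\
  bubble_forms v r hkd = poly_forms R d r k `&` ker_boundary_trace v k.
Proof.
move=> hkd; have d0 : (0 < d)%N by apply: leq_trans hd.
split; first exact: bubble_forms_directP.
by apply/seteqP; split; [apply: bubble_forms_sub|apply: bubble_forms_sup].
Qed.
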